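(* Let $\mathcal P=\{\mathbb P_X\mathbb P_{Y\mid X}:\mathbb P_X\in\mathcal P_X,\ \mathbb P_{Y\mid X}\in\mathcal P_{Y\mid X}\}$, $\mathbb P^*=\mathbb P_X^*\mathbb P^*_{Y\mid X}\in\mathcal P$, $\theta:\mathcal P\to\Theta\subseteq\mathbb R^p$, and let $\frac{N}{n+N}\to\gamma\in(0,1)$. Let $\varphi^*_{\eta^*}(z)$ be the efficient influence function of $\theta(\cdot)$ at $\mathbb P^*$ relative to $\mathcal P$ (in the i.i.d. sense). If $\theta(\cdot)$ is well-specified at $\mathbb P^*_{Y\mid X}$ relative to $\mathcal P_X$, i.e. $\theta(\mathbb P_X^*\mathbb P^*_{Y\mid X})=\theta(\mathbb P_X\mathbb P^*_{Y\mid X})$ for every $\mathbb P_X\in\mathcal P_X$, then the efficient influence function of $\theta(\cdot)$ at $\mathbb P^*$ relative to $\mathcal P$ under the ordinary semi-supervised (OSS) setting is $(z_1,x_2)\mapsto\varphi^*_{\eta^*}(z_1)$.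
   Context: $Z=(X,Y)\in\mathcal Z=\mathcal X\times\mathcal Y$, $Z\sim\mathbb P^*$. OSS setting: one observes $\mathcal L_n=\{Z_i\}_{i=1}^n$ i.i.d. from $\mathbb P^*$ and, independently, $\mathcal U_N=\{X_i\}_{i=n+1}^{n+N}$ i.i.d. from $\mathbb P_X^*$. Models are dominated, $\mathbb P_X^*\in\mathcal P_X$, $\mathbb P^*_{Y\mid X}\in\mathcal P_{Y\mid X}$. $\mathcal L^2_{p,0}(\mathbb P)$: square-integrable mean-zero $\mathbb R^p$-valued functions. i.i.d. notions: a one-dimensional regular parametric sub-model is $\{\mathbb P_t:t\in T\subset\mathbb R\}\subset\mathcal P$, $\mathbb P_{t^*}=\mathbb P^*$, differentiable in quadratic mean at $t^*$, with score $s_{t^*}(z)$; $s_{t^*,X}(x)$ denotes the score at $t^*$ of the induced marginal family. The tangent space $\mathcal T_{\mathcal P}(\mathbb P^* )$ is the closed linear span of the scores. $D\in\mathcal L^2_{p,0}(\mathbb P^* )$ is a gradient if $\frac{d}{dt}\theta(\mathbb P_t)|_{t=t^*}=\mathbb E[D(Z)s_{t^*}(Z)]$ for every sub-model, and the efficient influence function if also $a^\top D\in\mathcal T_{\mathcal P}(\mathbb P^* )$ for all $a\in\mathbb R^p$. OSS notions: let $\mathcal H$ be the Hilbert space of functions $f(z_1)+\frac{\gamma}{1-\gamma}g(x_2)$, $f\in\mathcal L^2_{p,0}(\mathbb P^* )$, $g\in\mathcal L^2_{p,0}(\mathbb P_X^* )$, with $\langle f_1+\frac{\gamma}{1-\gamma}g_1,\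 f_2^\top+\frac{\gamma}{1-\gamma}g_2^\top\rangle_{\mathcal H}=\mathbb E[f_1(Z)f_2(Z)^\top]+\frac{\gamma}{1-\gamma}\mathbb E[g_1(X)g_2(X)^\top]$. The OSS score of a sub-model is $l_{t^*}(z_1,x_2)=s_{t^*}(z_1)+\frac{\gamma}{1-\gamma}s_{t^*,X}(x_2)$; the OSS tangent space is the closed linear span in $\mathcal H$ of all OSS scores. $D(z_1,x_2)\in\mathcal H$ is an OSS gradient if $\frac{d}{dt}\theta(\mathbb P_t)|_{t=t^*}=\langle l_{t^*},D\rangle_{\mathcal H}$ for every sub-model, and the OSS canonical gradient if also $a^\top D$ lies in the OSS tangent space for all $a\in\mathbb R^p$. Normalization: OSS influence functions are written $\varphi^{(1)}(z_1)+\varphi^{(2)}(x_2)$, corresponding to $\sqrt n(\hat\theta_{n,N}-\theta^* )=n^{-1/2}\sum_{i=1}^n\varphi^{(1)}(Z_i)+N^{-1/2}\sum_{i=n+1}^{n+N}\varphi^{(2)}(X_i)+o_p(1)$; such a function is the efficient influence function under the OSS setting when $\varphi^{(1)}(z_1)+\sqrt{\gamma/(1-\gamma)}\,\varphi^{(2)}(x_2)$ is the OSS canonical gradient in $\mathcal H$. *)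

(* Defs.v *)
From HB Require Import structures.
From mathcomp Require Import all_boot all_order all_algebra.
From mathcomp Require Import all_classical all_reals all_analysis.

Set Implicit Arguments.
Unset Strict Implicit.
Unset Printing Implicit Defensive.

Import Order.TTheory GRing.Theory Num.Theory.
Import numFieldNormedType.Exports.

Local Open Scope classical_set_scope.
Local Open Scope ring_scope.

(** The law P_X P_{Y|X} on X * Y of a marginal law and a conditional law. *)
Section joint_law.
Context {d1 d2 : measure_display} {X : measurableType d1}
  {Y : measurableType d2} {R : realType}.
Variables (PX : probability X R) (k : R.-pker X ~> Y).

Definition joint (A : set (X * Y)) : \bar R :=
  (\int[PX]_x k x (xsection A x))%E.

Let joint0 : joint set0 = 0%E.
Proof.
by rewrite /joint integral0_eq// => x _; rewrite xsection0 measure0.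
Qed.

Let joint_ge0 A : (0 <= joint A)%E.
Proof. by apply: integral_ge0 => x _; exact: measure_ge0. Qed.

Let joint_sigma_additive : semi_sigma_additive joint.
Proof.
move=> F mF tF mUF.
rewrite [X in _ --> X](_ : _ = \sum_(n <oo) joint (F n))%E; last first.
  rewrite /joint -integral_nneseries//; last first.
    by move=> n; exact: (measurable_fun_xsection_finite_kernel k (mem_set (mF n))).
  apply: eq_integral => x _; rewrite xsection_bigcup.
  apply/esym/cvg_lim => //.
  apply: (@measure_semi_sigma_additive _ _ _ (k x)).
  - by move=> n; exact: measurable_xsection.
  - exact: trivIset_xsection.
  - by rewrite -xsection_bigcup; exact: measurable_xsection.
by apply: is_cvg_nneseries => n _ _; exact: joint_ge0.
Qed.

HB.instance Definition _ := isMeasure.Build _ _ _ joint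
  joint0 joint_ge0 joint_sigma_additive.

Let joint_setT : joint [set: X * Y] = 1%E.
Proof.
rewrite /joint (eq_integral (cst 1%E)); last first.
  by move=> x _; rewrite xsectionE/= preimage_setT prob_kernel.
by rewrite integral_cst//= mul1e probability_setT.
Qed.

HB.instance Definition _ := Measure_isProbability.Build _ _ _ joint joint_setT.

End joint_law.

Section marginal_law.
Context {d1 d2 : measure_display} {X : measurableType d1}
  {Y : measurableType d2} {R : realType}.

HB.instance Definition _ :=
  isMeasurableFun.Build _ _ _ _ (@fst X Y) measurable_fst.

Definition marginalX (P : probability (X * Y)%type R) : probability X R :=
  distribution P (@fst X Y).

End marginal_law.

Section L2.
Context {d : measure_display} {U : measurableType d} {R : realType}.
Variable P : probability U R.

Definition L2_0 (f : U -> R) : Prop :=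
  f \in Lfun P 2%:E /\ 'E_P[f]%E = 0%E.

(* L^2_{p,0}(P) *)
Definition L2_0v (p : nat) (f : U -> 'cV[R]_p) : Prop :=
  forall i, L2_0 (fun u => f u i 0).

(* a^T f *)
Definition dotv (p : nat) (a : 'cV[R]_p) (f : U -> 'cV[R]_p) : U -> R :=
  fun u => (a^T *m f u) 0 0.

Definition L2dot (f g : U -> R) : \bar R := 'E_P[f \* g]%E.

(* The closure is taken inside L^2_0(P); functions, not a.e.-classes, are used,
   so the result is automatically stable under modification on null sets. *)
Definition L2_closed_span (S : set (U -> R)) : set (U -> R) :=
  [set f | L2_0 f /\
    forall e : R, 0 < e ->
      exists (n : nat) (c : 'I_n -> R) (s : 'I_n -> U -> R),
        (forall i, S (s i)) /\
        let h := fun u => f u - \sum_(i < n) c i * s i u in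
        (L2dot h h < e%:E)%E].

End L2.

Section differentiability_in_quadratic_mean.
Context {d : measure_display} {U : measurableType d} {R : realType}.
Variable mu : {measure set U -> \bar R}.

Definition is_density (P : probability U R) (f : U -> R) : Prop :=
  [/\ measurable_fun [set: U] f, forall u, 0 <= f u &
      forall A, measurable A -> P A = (\int[mu]_(u in A) (f u)%:E)%E].

(* s is the score at t0 of the family {P_t : t in T}:
   int (sqrt p_t - sqrt p_t0 - (t - t0) / 2 * s * sqrt p_t0)^2 dmu
     = o((t - t0)^2). *)
Definition dqm (T : set R) (t0 : R) (P : R -> probability U R) (s : U -> R)
    : Prop :=
  s \in Lfun (P t0) 2%:E /\
  exists f : R -> U -> R,
    (forall t, T t -> is_density (P t) (f t)) /\
    (((t - t0) ^- 2)%:E *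
       \int[mu]_u ((Num.sqrt (f t u) - Num.sqrt (f t0 u)
         - (t - t0) / 2 * s u * Num.sqrt (f t0 u)) ^+ 2)%:E)%E
      @[t --> t0^'] --> 0%E.

End differentiability_in_quadratic_mean.

Section semiparametric.
Context {d1 d2 : measure_display} {X : measurableType d1}
  {Y : measurableType d2} {R : realType}.
Local Notation Z := (X * Y)%type.
Variables (muX : {sigma_finite_measure set X -> \bar R})
  (muY : {sigma_finite_measure set Y -> \bar R}).
Variables (MX : set (probability X R)) (MYX : set (R.-pker X ~> Y)).

Definition dominated_models : Prop :=
  (forall PX, MX PX -> PX `<< muX) /\
  (forall k, MYX k -> forall x, k x `<< muY).

Definition model : set (probability Z R) :=
  [set P | exists PX k, [/\ MX PX, MYX k & P = joint PX k]].

(* T is required to be a neighbourhood of t0, so that d/dt at t0 is a two-sided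
   derivative; P_t is irrelevant for t outside T. *)
Definition submodel (Pstar : probability Z R) (T : set R) (t0 : R)
    (P : R -> probability Z R) (s : Z -> R) : Prop :=
  [/\ nbhs t0 T, forall t, T t -> model (P t), P t0 = Pstar &
      dqm (muX \x muY)%E T t0 P s].

(* The score s_X of the induced marginal family. *)
Definition marginal_score (T : set R) (t0 : R) (P : R -> probability Z R)
    (sX : X -> R) : Prop :=
  dqm muX T t0 (fun t => marginalX (P t)) sX.

Section iid.
Variables (p : nat) (theta : probability Z R -> 'cV[R]_p).
Variable Pstar : probability Z R.

Definition scores : set (Z -> R) :=
  [set s | exists T t0 P, submodel Pstar T t0 P s].

Definition tangent_space : set (Z -> R) := L2_closed_span Pstar scores.

Definition gradient (D : Z -> 'cV[R]_p) : Prop :=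
  L2_0v Pstar D /\
  forall T t0 P s, submodel Pstar T t0 P s ->
    is_derive (t0 : R) (1 : R) (fun t => theta (P t))
      (\col_i fine (L2dot Pstar (fun z => D z i 0) s)).

Definition efficient_influence_function (D : Z -> 'cV[R]_p) : Prop :=
  gradient D /\ forall a : 'cV[R]_p, tangent_space (dotv a D).

Definition well_specified (PX : probability X R) (k : R.-pker X ~> Y) : Prop :=
  forall QX, MX QX -> theta (joint PX k) = theta (joint QX k).

End iid.

(* The pair (f, g) stands for the function f(z1) + gamma/(1-gamma) g(x2). For
   mean-zero f and g the function determines the pair. *)
Section oss.
Variable gamma : R.
Variables (p : nat) (theta : probability Z R -> 'cV[R]_p).
Variable Pstar : probability Z R.

Definition oss_ratio : R := gamma / (1 - gamma).

Definition oss_fun (f : Z -> 'cV[R]_p) (g : X -> 'cV[R]_p) : Z -> X -> 'cV[R]_p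
  := fun z1 x2 => f z1 + oss_ratio *: g x2.

(* Scalar inner product of H; the matrix-valued one for R^p-valued functions is
   its entrywise version. *)
Definition Hdot (h1 h2 : (Z -> R) * (X -> R)) : \bar R :=
  (L2dot Pstar h1.1 h2.1 + oss_ratio%:E * L2dot (marginalX Pstar) h1.2 h2.2)%E.

Definition oss_scores : set ((Z -> R) * (X -> R)) :=
  [set l | exists T t0 P,
    submodel Pstar T t0 P l.1 /\ marginal_score T t0 P l.2].

Definition oss_tangent_space : set ((Z -> R) * (X -> R)) :=
  [set h | [/\ L2_0 Pstar h.1, L2_0 (marginalX Pstar) h.2 &
    forall e : R, 0 < e ->
      exists (n : nat) (c : 'I_n -> R) (l : 'I_n -> (Z -> R) * (X -> R)),
        (forall i, oss_scores (l i)) /\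
        let r := (fun z => h.1 z - \sum_(i < n) c i * (l i).1 z,
                  fun x => h.2 x - \sum_(i < n) c i * (l i).2 x) in
        (Hdot r r < e%:E)%E]].

Definition oss_gradient (f : Z -> 'cV[R]_p) (g : X -> 'cV[R]_p) : Prop :=
  [/\ L2_0v Pstar f, L2_0v (marginalX Pstar) g &
    forall T t0 P s sX, submodel Pstar T t0 P s -> marginal_score T t0 P sX ->
      is_derive (t0 : R) (1 : R) (fun t => theta (P t))
        (\col_i fine (Hdot (s, sX)
                           (fun z => f z i 0, fun x => g x i 0)))].

Definition oss_canonical_gradient (D : Z -> X -> 'cV[R]_p) : Prop :=
  exists f g, [/\ D = oss_fun f g, oss_gradient f g &
    forall a : 'cV[R]_p, oss_tangent_space (dotv a f, dotv a g)].

(* An OSS influence function phi1(z1) + phi2(x2) carries the normalization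
   n^{-1/2} sum phi1 + N^{-1/2} sum phi2, hence the square root below. *)
Definition oss_efficient_influence_function (phi : Z -> X -> 'cV[R]_p) : Prop :=
  exists phi1 phi2,
    [/\ L2_0v Pstar phi1, L2_0v (marginalX Pstar) phi2,
        phi = (fun z1 x2 => phi1 z1 + phi2 x2) &
        oss_canonical_gradient
          (fun z1 x2 => phi1 z1 + Num.sqrt oss_ratio *: phi2 x2)].

End oss.

End semiparametric.

(* Main.v *)
Require Import Defs.
From HB Require Import structures.
From mathcomp Require Import all_boot all_order all_algebra.
From mathcomp Require Import all_classical all_reals all_analysis.
From mathcomp Require Import measurable_realfun ring lra.

Set Implicit Arguments.
Unset Strict Implicit.
Unset Printing Implicit Defensive.

Import Order.TTheory GRing.Theory Num.Theory.
Import numFieldNormedType.Exports.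

Local Open Scope classical_set_scope.
Local Open Scope ring_scope.

(** The OSS canonical gradient is the pair [(phi, 0)]. The score [sX] of the
marginal family of a sub-model is the conditional expectation of its score [s],
and perturbing only the marginal law along that family gives another sub-model,
with score [sX \o fst]. By well-specification theta is constant along it, hence
[phi] is orthogonal to every [sX \o fst]. Now let [S] be a combination of scores
close to [a^T phi] and [SX] the same combination of the marginal scores: as
[SX \o fst] is the projection of [S] and is orthogonal to [a^T phi],
[||SX|| <= ||a^T phi - S||], so that [(S, SX)] is close to [(a^T phi, 0)]. *)

(** An OSS score requires a marginal family that is itself differentiable in quadratic mean, so each
    score approximating [a^T phi] has to be completed by a marginal score whose existence must be
    proved. At fixed [x] the root of the marginal density is the norm of [sqrt f_t(x, .)] in
    L^2(muY). The reverse triangle inequality compares it, up to the error of the joint family, with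
    the norm of [(1 + h s / 2) sqrt f], which is [sqrt (p + h b + h^2 c / 4)] for [p], [b], [c] the
    integrals of [f], [s f], [s^2 f] over [y]. What is left is a one-variable estimate on
    [sqrt_remainder], followed by dominated convergence in [x]. In the converse direction the
    obstacle is measurability: domination of the conditional law by [muY] is given for each [x]
    separately, whereas the perturbed family needs densities measurable in [(x, y)]. They are cut
    out of Radon-Nikodym derivatives of joint laws, with one conditional density shared by all [t]
    wherever the base marginal density is positive, so that the joint and the marginal
    quadratic-mean errors coincide. *)

(** * The root of a nonnegative quadratic near its base point *)

Section sqrt_remainder.
Variables (R : realType).
Implicit Types p b c h : R.

(** [b / p] stands for the marginal score. Where [p] is 0 the quotient is 0 by convention, and the
    last term vanishes anyway through [Num.sqrt p]. *)
Definition sqrt_remainder p b c h : R :=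
  Num.sqrt (p + h * b + h ^+ 2 / 4 * c) - Num.sqrt p
    - h / 2 * (b / p) * Num.sqrt p.

(** For [p > 0], [p] times the quadratic is [(p + h b / 2)^2 + h^2 (p c - b^2) / 4]; for [p = 0] the
    hypothesis forces [b = 0]. *)
Lemma discriminant_ge0 p b c h : 0 <= p -> 0 <= c -> b ^+ 2 <= p * c ->
  0 <= p + h * b + h ^+ 2 / 4 * c.
Proof.
move=> p0 c0 bpc; have [pz|pn0] := eqVneq p 0.
  move: bpc; rewrite pz mul0r => b0.
  have -> : b = 0 by apply/eqP; rewrite -sqrf_eq0 eq_le b0 sqr_ge0.
  nra.
have pp : 0 < p by rewrite lt_neqAle eq_sym pn0.
rewrite -(pmulr_rge0 _ pp).
have : 0 <= (p + h * b / 2) ^+ 2 by exact: sqr_ge0.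
have : 0 <= h ^+ 2 * (p * c - b ^+ 2) by rewrite mulr_ge0 ?sqr_ge0// subr_ge0.
nra.
Qed.

(** Abstract form of the reverse triangle inequality: with [q] the quadratic, expansion reduces it
    to [2 p + h b <= 2 sqrt (p q)], and [4 p q - (2 p + h b)^2 = h^2 (p c - b^2)]. *)
Lemma sqrt_remainder_sqr_le p b c h : 0 <= p -> 0 <= c -> b ^+ 2 <= p * c ->
  (Num.sqrt (p + h * b + h ^+ 2 / 4 * c) - Num.sqrt p) ^+ 2 <= h ^+ 2 / 4 * c.
Proof.
move=> p0 c0 bpc.
have q0 := discriminant_ge0 h p0 c0 bpc.
set q := p + _ + _ in q0 *.
rewrite sqrrB !sqr_sqrtr//.
suff : 2 * p + h * b <= 2 * (Num.sqrt q * Num.sqrt p) by rewrite /q; lra.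
rewrite -sqrtrM//; apply: (le_trans (ler_norm _)); rewrite -sqrtr_sqr.
rewrite -[2 in leRHS]gtr0_norm// -sqrtr_sqr -sqrtrM ?sqr_ge0// ler_sqrt//.
  rewrite /q; have : 0 <= h ^+ 2 * (p * c - b ^+ 2).
    by rewrite mulr_ge0 ?sqr_ge0// subr_ge0.
  nra.
by rewrite mulr_ge0 ?sqr_ge0// mulr_ge0.
Qed.

(* With [A ^+ 2 = p + h b + h ^+ 2 c / 4] and [r ^+ 2 = p], the remainder D
   satisfies [2 r D = h ^+ 2 c / 4 - (A - r) ^+ 2]. *)
Lemma sqrt_remainder_bound p b c h : 0 <= p -> 0 <= c -> b ^+ 2 <= p * c ->
  (p = 0 -> c = 0) ->
  sqrt_remainder p b c h ^+ 2 <= h ^+ 4 * (c ^+ 2 / (64 * p)).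
Proof.
move=> p0 c0 bpc pc; rewrite /sqrt_remainder; have [pz|pn0] := eqVneq p 0.
  have cz := pc pz; move: bpc; rewrite pz cz mul0r => b0.
  have -> : b = 0 by apply/eqP; rewrite -sqrf_eq0 eq_le b0 sqr_ge0.
  by rewrite !(mulr0, mul0r, addr0, sqrtr0, subr0, expr0n)/= ?mulr0 ?mul0r.
have pp : 0 < p by rewrite lt_neqAle eq_sym pn0.
have rp : 0 < Num.sqrt p by rewrite sqrtr_gt0.
have := sqrt_remainder_sqr_le h p0 c0 bpc.
have q0 := discriminant_ge0 h p0 c0 bpc.
set q := p + _ + _ in q0 *.
have : Num.sqrt p ^+ 2 = p by rewrite sqr_sqrtr.
have : Num.sqrt q ^+ 2 = q by rewrite sqr_sqrtr.
rewrite {2}/q; set A := Num.sqrt q; set r := Num.sqrt p in rp *.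
move=> A2 r2 Ar; set D := A - r - _.
have DE : 2 * r * D = h ^+ 2 / 4 * c - (A - r) ^+ 2.
  have -> : 2 * r * D = 2 * r * (A - r) - h * b * (r ^+ 2 / p).
    by rewrite /D; field.
  by rewrite r2 divff// mulr1 -{1}[h * b](addrK (h ^+ 2 / 4 * c + p)); nra.
have D1 : 0 <= 2 * r * D by rewrite DE; lra.
have D2 : 2 * r * D <= h ^+ 2 / 4 * c by rewrite DE; have := sqr_ge0 (A - r); lra.
(* This reads [4 p D^2 <= h^4 c^2 / 16], whence the constant 64. *)
have : (2 * r * D) ^+ 2 <= (h ^+ 2 / 4 * c) ^+ 2.
  by rewrite ler_pXn2r// nnegrE// (le_trans D1).
rewrite 2!exprMn r2 => H.
have -> : h ^+ 4 * (c ^+ 2 / (64 * p)) = (h ^+ 2 / 4 * c) ^+ 2 / (4 * p).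
  by field.
by rewrite ler_pdivlMr ?mulr_gt0//; lra.
Qed.

(** Only of order [h^2], but with no [p] in a denominator, so that it can serve as a dominating
    function. The remainder is [x - y] with [x^2] and [y^2] at most [h^2 c / 4], and
    [(x - y)^2 <= 2 x^2 + 2 y^2]. *)
Lemma sqrt_remainder_dom p b c h : 0 <= p -> 0 <= c -> b ^+ 2 <= p * c ->
  sqrt_remainder p b c h ^+ 2 <= h ^+ 2 * c.
Proof.
move=> p0 c0 bpc; have := sqrt_remainder_sqr_le h p0 c0 bpc.
rewrite /sqrt_remainder; set x := (_ - Num.sqrt p) => x2; set y := h / 2 * _ * _.
have y2 : y ^+ 2 <= h ^+ 2 / 4 * c.
  rewrite /y exprMn sqr_sqrtr//; have [->|pn0] := eqVneq p 0.
    by rewrite mulr0; nra.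
  have pp : 0 < p by rewrite lt_neqAle eq_sym pn0.
  have -> : (h / 2 * (b / p)) ^+ 2 * p = h ^+ 2 / 4 * (b ^+ 2 / p).
    by field.
  by rewrite ler_wpM2l ?divr_ge0 ?sqr_ge0// ler_pdivrMr// mulrC.
have := sqr_ge0 (x + y); nra.
Qed.

End sqrt_remainder.

(** * Cauchy-Schwarz and the reverse triangle inequality in L^2 *)

Section square_integrable.
Context d (T : measurableType d) (R : realType).
Variable mu : {measure set T -> \bar R}.
Implicit Types a b f g : T -> R.

Local Notation intb f := (mu.-integrable [set: T] (EFin \o f)).

Lemma integrable_EFinD f g : intb f -> intb g -> intb (fun x => f x + g x).
Proof. by move=> If Ig; exact: (integrableD measurableT If Ig). Qed.

Lemma integrable_EFinB f g : intb f -> intb g -> intb (fun x => f x - g x).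
Proof. by move=> If Ig; exact: (integrableB measurableT If Ig). Qed.

Lemma integrable_EFinZl (k : R) f : intb f -> intb (fun x => k * f x).
Proof. by move=> If; exact: (integrableZl measurableT k If). Qed.

Lemma Lfun2_measurable f : f \in Lfun mu 2%:E -> measurable_fun [set: T] f.
Proof. by rewrite inE => /andP[]; rewrite inE. Qed.

Lemma integrable_mul_sqr a b :
  measurable_fun [set: T] a -> measurable_fun [set: T] b ->
  intb (fun x => a x ^+ 2) -> intb (fun x => b x ^+ 2) ->
  intb (fun x => a x * b x).
Proof.
move=> ma mb ia ib.
apply: (le_integrable measurableT _ _ (integrable_EFinD ia ib)).
  by apply/measurable_EFinP; exact: measurable_funM.
move=> x _ /=; rewrite lee_fin normrM.
rewrite [leRHS]ger0_norm ?addr_ge0 ?sqr_ge0//.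
rewrite -[a x ^+ 2]real_normK ?num_real// -[b x ^+ 2]real_normK ?num_real//.
have := sqr_ge0 (`|a x| - `|b x|); have := sqr_ge0 (`|a x| + `|b x|); nra.
Qed.

Lemma integrable_sqr_Lfun f : measurable_fun [set: T] f ->
  intb (fun x => f x ^+ 2) -> f \in Lfun mu 2%:E.
Proof.
move=> mf /integrableP[_ If]; rewrite inE; apply/andP; split; rewrite inE//=.
rewrite /finite_norm unlock/= poweR_lty//.
apply: le_lt_trans If; apply: ge0_le_integral => //=.
- apply/measurable_EFinP.
  apply: (@measurableT_comp _ _ _ _ _ _ (fun x : R => x `^ 2)%R) => //.
  exact/measurableT_comp.
- by apply/measurable_EFinP; apply: measurableT_comp => //; exact: measurable_funX.
- by move=> x _; rewrite lee_fin normrX powR_mulrn.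
Qed.

Section inner_product.
Variables a b : T -> R.
Hypotheses (ma : measurable_fun [set: T] a) (mb : measurable_fun [set: T] b).
Hypotheses (ia : intb (fun x => a x ^+ 2)) (ib : intb (fun x => b x ^+ 2)).

Let iab := integrable_mul_sqr ma mb ia ib.

Lemma sqrrB_integrable (l : R) : intb (fun x => (a x - l * b x) ^+ 2).
Proof.
rewrite (_ : (fun x => _) = fun x =>
    a x ^+ 2 + (l ^+ 2 * b x ^+ 2 - 2 * l * (a x * b x))); last first.
  by apply/funext => x; ring.
by apply: integrable_EFinD => //; apply: integrable_EFinB;
  exact: integrable_EFinZl.
Qed.

Lemma Rintegral_sqrrB (l : R) :
  \int[mu]_x ((a x - l * b x) ^+ 2) =
  \int[mu]_x (a x ^+ 2) + (l ^+ 2 * \int[mu]_x (b x ^+ 2)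
    - 2 * l * \int[mu]_x (a x * b x)).
Proof.
rewrite (_ : (fun x => _) = fun x =>
    a x ^+ 2 + (l ^+ 2 * b x ^+ 2 - 2 * l * (a x * b x))); last first.
  by apply/funext => x; ring.
rewrite RintegralD//; last by apply: integrable_EFinB; exact: integrable_EFinZl.
by rewrite RintegralB ?RintegralZl//; exact: integrable_EFinZl.
Qed.

(** The integral of [(a - l b)^2] is a nonnegative quadratic in [l]; its value at the minimiser
    [C / B] is [(A B - C^2) / B]. *)
Lemma Rintegral_cauchy_schwarz :
  (\int[mu]_x (a x * b x)) ^+ 2 <=
  \int[mu]_x (a x ^+ 2) * \int[mu]_x (b x ^+ 2).
Proof.
have H l : 0 <= \int[mu]_x (a x ^+ 2) + (l ^+ 2 * \int[mu]_x (b x ^+ 2)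
    - 2 * l * \int[mu]_x (a x * b x)).
  by rewrite -Rintegral_sqrrB; apply: Rintegral_ge0 => x _; exact: sqr_ge0.
move: H; set A := \int[mu]_x (a x ^+ 2); set B := \int[mu]_x (b x ^+ 2).
set C := \int[mu]_x _ => H.
have A0 : 0 <= A by apply: Rintegral_ge0 => x _; exact: sqr_ge0.
have B0 : 0 <= B by apply: Rintegral_ge0 => x _; exact: sqr_ge0.
have [Bz|Bn0] := eqVneq B 0.
  have [->|Cn0] := eqVneq C 0; first by rewrite expr0n/= mulr_ge0.
  (* For [B = 0] the quadratic is affine in [l]; at this point it would equal -1. *)
  have := H ((A + 1) / (2 * C)); rewrite Bz mulr0 sub0r.
  have -> : 2 * ((A + 1) / (2 * C)) * C = A + 1 by field.
  lra.
have Bp : 0 < B by rewrite lt_neqAle eq_sym Bn0.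
have := H (C / B).
have -> : A + ((C / B) ^+ 2 * B - 2 * (C / B) * C) = (A * B - C ^+ 2) / B by field.
by rewrite pmulr_lge0 ?invr_gt0// subr_ge0.
Qed.

(** Expanding both squares leaves Cauchy-Schwarz: this is the reverse triangle inequality for the
    L^2 norm. *)
Lemma sqrt_Rintegral_dist :
  (Num.sqrt (\int[mu]_x (a x ^+ 2)) - Num.sqrt (\int[mu]_x (b x ^+ 2))) ^+ 2
  <= \int[mu]_x ((a x - b x) ^+ 2).
Proof.
have -> : (fun x => (a x - b x) ^+ 2) = (fun x => (a x - 1 * b x) ^+ 2).
  by apply/funext => x; rewrite mul1r.
rewrite Rintegral_sqrrB; have := Rintegral_cauchy_schwarz.
set A := \int[mu]_x (a x ^+ 2); set B := \int[mu]_x (b x ^+ 2).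
set C := \int[mu]_x _ => CAB.
have A0 : 0 <= A by apply: Rintegral_ge0 => x _; exact: sqr_ge0.
have B0 : 0 <= B by apply: Rintegral_ge0 => x _; exact: sqr_ge0.
rewrite sqrrB !sqr_sqrtr//.
suff : C <= Num.sqrt A * Num.sqrt B by lra.
rewrite -sqrtrM// (le_trans (ler_norm _))// -sqrtr_sqr ler_sqrt//.
exact: mulr_ge0.
Qed.

End inner_product.

End square_integrable.

(** * Integration against a law with a density *)

Section density.
Context d (T : measurableType d) (R : realType).
Variable mu : {sigma_finite_measure set T -> \bar R}.
Variables (P : probability T R) (f : T -> R).
Hypothesis Pf : is_density mu P f.

Lemma density_dominates : P `<< mu.
Proof.
have [mf _ PE] := Pf.
apply/null_content_dominatesP => A mA muA0.
rewrite PE// null_set_integral//; apply/measurable_EFinP.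
exact: measurable_funTS.
Qed.

Lemma density_integrable : mu.-integrable [set: T] (EFin \o f).
Proof.
have [mf f0 PE] := Pf.
apply/integrableP; split; first exact/measurable_EFinP.
under eq_integral => x _ do rewrite gee0_abs ?lee_fin//.
by rewrite -PE// probability_setT ltry.
Qed.

(** Change of variables holds for the Radon-Nikodym derivative; [f] agrees with it a.e., having the
    same integral over every measurable set. *)
Lemma density_ge0_integral (g : T -> \bar R) : measurable_fun [set: T] g ->
  (forall x, 0 <= g x)%E ->
  (\int[P]_x g x = \int[mu]_x (g x * (f x)%:E))%E.
Proof.
move=> mg g0; have [mf f0 PE] := Pf; have Pmu := density_dominates.
rewrite -(Radon_Nikodym_SigmaFinite.change_of_variables Pmu)//.
have mRN := measurable_int _ (Radon_Nikodym_SigmaFinite.f_integrable Pmu).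
apply: ae_eq_integral => //.
- exact: emeasurable_funM.
- by apply: emeasurable_funM => //; exact/measurable_EFinP.
apply: ae_eqe_mul2l; apply: integral_ae_eq => //.
- exact: Radon_Nikodym_SigmaFinite.f_integrable.
- exact/measurable_EFinP.
- move=> E _ mE; transitivity (P E); last exact: PE.
  exact/esym/Radon_Nikodym_SigmaFinite.f_integral.
Qed.

Lemma density_integrableP (g : T -> R) : measurable_fun [set: T] g ->
  P.-integrable [set: T] (EFin \o g) <->
  mu.-integrable [set: T] (EFin \o (fun x => g x * f x)).
Proof.
move=> mg; have [mf f0 PE] := Pf.
have E : (\int[P]_x `|(EFin \o g) x| = \int[mu]_x `|(g x * f x)%:E|)%E.
  rewrite density_ge0_integral//; last first.
    by apply/measurable_EFinP; exact: measurableT_comp.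
  by apply: eq_integral => x _; rewrite /= normrM (ger0_norm (f0 x)).
split=> /integrableP[_ I]; apply/integrableP; split.
- by apply/measurable_EFinP; exact: measurable_funM.
- by rewrite -E.
- exact/measurable_EFinP.
- by rewrite E.
Qed.

Lemma density_integral (g : T -> R) : measurable_fun [set: T] g ->
  (\int[P]_x (g x)%:E = \int[mu]_x (g x * f x)%:E)%E.
Proof.
move=> mg; have [mf f0 PE] := Pf.
have mEg : measurable_fun [set: T] (EFin \o g) by exact/measurable_EFinP.
rewrite integralE [RHS]integralE; congr (_ - _)%E.
  rewrite density_ge0_integral//; last exact: measurable_funepos.
  apply: eq_integral => x _.
  by rewrite !funeposE EFinM maxe_pMl ?mul0e// lee_fin.
rewrite density_ge0_integral//; last exact: measurable_funeneg.
apply: eq_integral => x _.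
by rewrite !funenegE EFinM maxe_pMl ?mul0e ?mulNe// lee_fin.
Qed.

End density.

Lemma measurable_sqrtr (R : realType) : measurable_fun [set: R] (@Num.sqrt R).
Proof. by apply: continuous_measurable_fun; exact: sqrt_continuous. Qed.

(** * Linearisation of the root density on one section *)

Section quadratic_mean_slice.
Context d (T : measurableType d) (R : realType).
Variable mu : {measure set T -> \bar R}.

Local Notation intb f := (mu.-integrable [set: T] (EFin \o f)).

Variables f s : T -> R.
Hypotheses (mf : measurable_fun [set: T] f) (ms : measurable_fun [set: T] s).
Hypothesis f0 : forall x, 0 <= f x.
Hypotheses (If : intb f) (Isf : intb (fun x => s x ^+ 2 * f x)).

Let rf := fun x => Num.sqrt (f x).
Let srf := fun x => s x * Num.sqrt (f x).

Let mrf : measurable_fun [set: T] rf.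
Proof. by apply: measurableT_comp => //; exact: measurable_sqrtr. Qed.

Let msrf : measurable_fun [set: T] srf.
Proof. exact: measurable_funM. Qed.

Let rf2 : (fun x => rf x ^+ 2) = f.
Proof. by apply/funext => x; rewrite sqr_sqrtr. Qed.

Let srf2 : (fun x => srf x ^+ 2) = (fun x => s x ^+ 2 * f x).
Proof. by apply/funext => x; rewrite exprMn sqr_sqrtr. Qed.

Let rfsrf : (fun x => rf x * srf x) = (fun x => s x * f x).
Proof. by apply/funext => x; rewrite mulrCA -expr2 sqr_sqrtr. Qed.

Let Irf : intb (fun x => rf x ^+ 2). Proof. by rewrite rf2. Qed.

Let Isrf : intb (fun x => srf x ^+ 2). Proof. by rewrite srf2. Qed.

Local Notation p := (\int[mu]_x f x).
Local Notation b := (\int[mu]_x (s x * f x)).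
Local Notation c := (\int[mu]_x (s x ^+ 2 * f x)).

Lemma integrable_mul_density : intb (fun x => s x * f x).
Proof. by rewrite -rfsrf; exact: integrable_mul_sqr. Qed.

Lemma weighted_cauchy_schwarz : b ^+ 2 <= p * c.
Proof.
by have := Rintegral_cauchy_schwarz mrf msrf Irf Isrf; rewrite rf2 srf2 rfsrf.
Qed.

Lemma weighted_sqr_eq0 : p = 0 -> c = 0.
Proof.
move=> p0; have : (\int[mu]_x `|(f x)%:E| = 0)%E.
  under eq_integral do rewrite gee0_abs ?lee_fin//.
  have := integrable_fin_num measurableT If => /fineK <-.
  by congr EFin.
move=> /(ae_eq_integral_abs mu measurableT)[//|]; first exact/measurable_EFinP.
move=> N [mN [N0 sN]]; rewrite /Rintegral (@ae_eq_integral _ _ _ _ _ (cst 0%E))//.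
- by rewrite integral0.
- apply/measurable_EFinP; apply: measurable_funM => //.
  exact: measurable_funX.
exists N; split => // x /= H; apply: sN => /= H'; apply: H => _.
by have [->] := H' I; rewrite mulr0.
Qed.

(** Insert the norm [B] of [v = (1 + h s / 2) sqrt f] between the norm of [sqrt q] and the
    linearisation. The first gap is controlled by the integral of [g] through the reverse triangle
    inequality, the second is [sqrt_remainder]; the factors 2 come from
    [(u + v)^2 <= 2 u^2 + 2 v^2]. *)
Lemma sqrt_Rintegral_linearization (q : T -> R) (h : R) :
  measurable_fun [set: T] q -> (forall x, 0 <= q x) -> intb q ->
  let g := fun x =>
    (Num.sqrt (q x) - Num.sqrt (f x) - h / 2 * s x * Num.sqrt (f x)) ^+ 2 in
  intb g /\
  (Num.sqrt (\int[mu]_x q x) - Num.sqrt p - h / 2 * (b / p) * Num.sqrt p) ^+ 2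
    <= 2 * \int[mu]_x g x + 2 * sqrt_remainder p b c h ^+ 2.
Proof.
move=> mq q0 Iq g; pose rq := fun x => Num.sqrt (q x).
have mrq : measurable_fun [set: T] rq.
  by apply: measurableT_comp => //; exact: measurable_sqrtr.
have rq2 : (fun x => rq x ^+ 2) = q by apply/funext => x; rewrite sqr_sqrtr.
have Irq : intb (fun x => rq x ^+ 2) by rewrite rq2.
pose v := fun x => rf x - (- (h / 2)) * srf x.
have mv : measurable_fun [set: T] v.
  by apply: measurable_funB => //; exact: measurable_funM.
have Iv : intb (fun x => v x ^+ 2) by exact: sqrrB_integrable.
have gE : g = (fun x => (rq x - v x) ^+ 2).
  by apply/funext => x; rewrite /g /rq /v /rf /srf; congr (_ ^+ 2); ring.
have := sqrt_Rintegral_dist mrq mv Irq Iv; rewrite rq2 -gE.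
rewrite (Rintegral_sqrrB mrf msrf Irf Isrf) rf2 srf2 rfsrf.
have -> : p + ((- (h / 2)) ^+ 2 * c - 2 * (- (h / 2)) * b) =
    p + h * b + h ^+ 2 / 4 * c by field.
move=> H; split.
  rewrite gE (_ : (fun x => _) = (fun x => (rq x - 1 * v x) ^+ 2)).
    exact: sqrrB_integrable.
  by apply/funext => x; rewrite mul1r.
move: H; rewrite /sqrt_remainder; set A := Num.sqrt _; set B := Num.sqrt _.
set C := Num.sqrt p; set D := h / 2 * _ * _; set G := \int[mu]_x g x => H.
have := sqr_ge0 ((A - B) - (B - C - D)); nra.
Qed.

End quadratic_mean_slice.

(** * Integrating out the second coordinate *)

Section partial_integral.
Context d1 d2 (X : measurableType d1) (Y : measurableType d2) (R : realType).
Variables (muX : {sigma_finite_measure set X -> \bar R})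
  (muY : {sigma_finite_measure set Y -> \bar R}).
Implicit Types g : X * Y -> R.

(** Real-valued, so that marginal densities can be divided and put under roots. For integrable [g]
    it agrees with the extended-real partial integral at almost every [x]. *)
Definition pint g (x : X) : R := \int[muY]_y g (x, y).

Section integrable.
Variable g : X * Y -> R.
Hypothesis Ig : (muX \x muY)%E.-integrable [set: X * Y] (EFin \o g).

Let pintE : pint g = fine \o fubini_F muY (EFin \o g).
Proof. by []. Qed.

Lemma measurable_pint : measurable_fun [set: X] (pint g).
Proof.
rewrite pintE; apply: (measurableT_comp (fine_measurable measurableT)).
exact: (measurable_fubini_F Ig).
Qed.

Lemma integrable_section_ae :
  {ae muX, forall x, muY.-integrable [set: Y] (EFin \o (fun y => g (x, y)))}.
Proof. exact: ae_integrable1 Ig. Qed.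

Let pint_ae : ae_eq muX setT (fubini_F muY (EFin \o g)) (EFin \o pint g).
Proof.
have := integrable_section_ae; apply: filterS => x Igx _.
rewrite /= /pint /Rintegral /fubini_F fineK//.
exact: integrable_fin_num.
Qed.

Lemma integral_pint :
  (\int[muX]_x (pint g x)%:E = \int[(muX \x muY)%E]_z (g z)%:E)%E.
Proof.
rewrite -(integral12_prod_meas1 Ig); apply: ae_eq_integral => //.
- by apply/measurable_EFinP; exact: measurable_pint.
- exact: (measurable_fubini_F Ig).
exact/ae_eq_sym.
Qed.

Lemma integrable_pint : muX.-integrable [set: X] (EFin \o pint g).
Proof.
apply/integrableP; split; first by apply/measurable_EFinP; exact: measurable_pint.
have /integrableP[_] := integrable_fubini_F Ig.
apply: le_lt_trans; rewrite le_eqVlt; apply/orP; left; apply/eqP.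
apply: ae_eq_integral => //.
- apply: measurableT_comp => //; apply/measurable_EFinP.
  exact: measurable_pint.
- by apply: measurableT_comp => //; exact: (measurable_fubini_F Ig).
by apply: filterS pint_ae => x H _; rewrite -H.
Qed.

End integrable.

Lemma pint_fst (u : X -> R) g :
  (muX \x muY)%E.-integrable [set: X * Y] (EFin \o g) ->
  {ae muX, forall x, pint (fun z => u z.1 * g z) x = u x * pint g x}.
Proof.
move=> /integrable_section_ae; apply: filterS => x Igx.
by rewrite /pint -(RintegralZl (u x) measurableT Igx).
Qed.

End partial_integral.

(** * Sigma-finiteness of the product measure *)

Section sigma_finite_product.
Context d1 d2 (X : measurableType d1) (Y : measurableType d2) (R : realType).
Variables (muX : {sigma_finite_measure set X -> \bar R})
  (muY : {sigma_finite_measure set Y -> \bar R}).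

(* An alias, because the only sigma-finite structure that type inference finds on
   [muX \x muY] is the one of a product of subprobabilities. *)
Definition sigma_finite_prod : set (X * Y) -> \bar R := (muX \x muY)%E.

HB.instance Definition _ := Measure.copy sigma_finite_prod (muX \x muY)%E.

Let sigma_finite_prod_sigma_finite : sigma_finite setT sigma_finite_prod.
Proof.
have /sigma_finiteP[F [TF ndF Foo]] := sigma_finiteT muX.
have /sigma_finiteP[G [TG ndG Goo]] := sigma_finiteT muY.
exists (fun n => F n `*` G n) => [|n].
  apply/esym/seteqP; split => // -[x y] _.
  have [k _ Fkx] : (\bigcup_k F k) x by rewrite -TF.
  have [l _ Gly] : (\bigcup_k G k) y by rewrite -TG.
  exists (maxn k l) => //; split.
    exact: (subsetPset _ _ (ndF _ _ (leq_maxl k l))).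
  exact: (subsetPset _ _ (ndG _ _ (leq_maxr k l))).
have [mF Fn] := Foo n; have [mG Gn] := Goo n; split; first exact: measurableX.
rewrite -[X in (X < _)%E]/((muX \x muY)%E _) product_measure1E//.
by rewrite lte_mul_pinfty// ge0_fin_numE.
Qed.

HB.instance Definition _ := Measure_isSigmaFinite.Build _ _ _ sigma_finite_prod
  sigma_finite_prod_sigma_finite.

End sigma_finite_product.

Section ae_le_integrable.
Context d (T : measurableType d) (R : realType).
Variable mu : {measure set T -> \bar R}.

Lemma ae_le_integrable (f g : T -> R) : measurable_fun [set: T] f ->
  (forall x, 0 <= f x) -> {ae mu, forall x, f x <= g x} ->
  mu.-integrable [set: T] (EFin \o g) -> mu.-integrable [set: T] (EFin \o f).
Proof.
move=> mf f0 fg /integrableP[mg Ig]; apply/integrableP.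
split; first exact/measurable_EFinP.
apply: le_lt_trans Ig; apply: ae_ge0_le_integral => //.
- by apply: measurableT_comp => //; exact/measurable_EFinP.
- exact: measurableT_comp.
- apply: filterS fg => x fgx _; rewrite /= lee_fin ger0_norm//.
  exact: le_trans fgx (ler_norm _).
Qed.

End ae_le_integrable.

(** * The marginal score as a conditional expectation *)

Section marginal_score.
Context d1 d2 (X : measurableType d1) (Y : measurableType d2) (R : realType).
Variables (muX : {sigma_finite_measure set X -> \bar R})
  (muY : {sigma_finite_measure set Y -> \bar R}).
Local Notation Z := (X * Y)%type.
Local Notation mu := (muX \x muY)%E.
Local Notation sfmu := (sigma_finite_prod muX muY).
Local Notation pint := (pint muY).

Lemma is_density_marginalX (P : probability Z R) (f : Z -> R) :
  is_density mu P f -> is_density muX (marginalX P) (pint f).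
Proof.
move=> Pf; have If := density_integrable (mu := sfmu) Pf; have [mf f0 PE] := Pf.
split.
- exact: measurable_pint If.
- by move=> x; apply: Rintegral_ge0 => y _.
move=> A mA; have mA' : measurable (fst @^-1` A : set Z).
  by rewrite -[X in measurable X]setTI; exact: measurable_fst.
have Ig : mu.-integrable [set: Z] (EFin \o (fun z => \1_A z.1 * f z)).
  apply: ae_le_integrable If => //.
  - apply: measurable_funM => //.
    by apply: measurableT_comp => //; exact: measurable_indic.
  - by move=> z; rewrite mulr_ge0.
  - by apply: aeW => z; rewrite indicE ler_piMl// lern1 leq_b1.
transitivity (\int[muX]_x (pint (fun z => \1_A z.1 * f z) x)%:E)%E.
  rewrite (integral_pint Ig) -[LHS]/(P (fst @^-1` A)) PE// integral_mkcond.
  apply: eq_integral => z _; rewrite epatch_indic EFinM muleC; congr (_ * _)%E.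
rewrite integral_mkcond; apply: ae_eq_integral => //.
- by apply/measurable_EFinP; exact: measurable_pint Ig.
- apply/(measurable_restrictT _ mA)/measurable_funTS/measurable_EFinP.
  exact: measurable_pint If.
apply: filterS (pint_fst \1_A If) => x -> _.
by rewrite epatch_indic EFinM muleC.
Qed.

Lemma Lfun2_comp_fst (P : probability Z R) (u : X -> R) :
  u \in Lfun (marginalX P) 2%:E -> (u \o fst) \in Lfun P 2%:E.
Proof.
move=> uL; have mu_ := Lfun2_measurable uL.
have /integrableP[_ I] := Lfun2_integrable_sqr uL.
apply: integrable_sqr_Lfun; first exact: measurableT_comp.
apply/integrableP; split.
  by apply/measurable_EFinP; apply: measurable_funX; exact: measurableT_comp.
move: I; rewrite ge0_integral_distribution//.
apply: measurableT_comp => //; apply/measurable_EFinP.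
exact: measurable_funX.
Qed.

Section score.
Variables (P : probability Z R) (f s : Z -> R).
Hypotheses (Pf : is_density mu P f) (sL : s \in Lfun P 2%:E).

Let mf : measurable_fun [set: Z] f. Proof. by have [] := Pf. Qed.

Let f0 z : 0 <= f z. Proof. by have [] := Pf. Qed.

Let ms : measurable_fun [set: Z] s. Proof. exact: Lfun2_measurable sL. Qed.

Let If : mu.-integrable [set: Z] (EFin \o f).
Proof. exact: (density_integrable (mu := sfmu) Pf). Qed.

Let Issf : mu.-integrable [set: Z] (EFin \o (fun z => s z ^+ 2 * f z)).
Proof.
have ms2 : measurable_fun [set: Z] (fun z => s z ^+ 2) by exact: measurable_funX.
apply/(density_integrableP (mu := sfmu) Pf ms2).
exact: Lfun2_integrable_sqr sL.
Qed.

Let Isf : mu.-integrable [set: Z] (EFin \o (fun z => s z * f z)).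
Proof. exact: integrable_mul_density. Qed.

Let p := pint f.
Let b := pint (fun z => s z * f z).
Let c := pint (fun z => s z ^+ 2 * f z).

(** Supplies, section by section, the hypotheses of the bounds on [sqrt_remainder]; the argument
    runs at those [x] where the sections of [f] and [s^2 f] are integrable. *)
Lemma score_section_ae : {ae muX, forall x,
  [/\ 0 <= p x, 0 <= c x, b x ^+ 2 <= p x * c x & p x = 0 -> c x = 0]}.
Proof.
have := integrable_section_ae Issf; have := integrable_section_ae If.
apply: filterS2 => x Ifx Issfx.
have mfx : measurable_fun [set: Y] (fun y => f (x, y)) by exact: measurableT_comp.
have msx : measurable_fun [set: Y] (fun y => s (x, y)) by exact: measurableT_comp.
split.
- by apply: Rintegral_ge0 => y _.
- by apply: Rintegral_ge0 => y _; rewrite mulr_ge0 ?sqr_ge0.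
- exact: (weighted_cauchy_schwarz mfx msx).
- exact: (weighted_sqr_eq0 mfx msx).
Qed.

(* The conditional expectation of [s] given the first coordinate; it is [0] where
   the marginal density vanishes. *)
Definition cond_score (x : X) : R := b x / p x.

(** Where [p x = 0], Cauchy-Schwarz forces [b x = 0], so the default value of the quotient does no
    harm. *)
Lemma cond_scoreM_ae : {ae muX, forall x, cond_score x * p x = b x}.
Proof.
apply: filterS score_section_ae => x [p0 c0 bpc _]; rewrite /cond_score.
have [px0|pxn0] := eqVneq (p x) 0; last by rewrite divfK.
move: bpc; rewrite px0 mul0r mulr0 => b0.
by apply/esym/eqP; rewrite -sqrf_eq0 eq_le b0 sqr_ge0.
Qed.

Lemma measurable_cond_score : measurable_fun [set: X] cond_score.
Proof.
apply: measurable_funM; first exact: measurable_pint Isf.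
(* Measurability of the inverse is read off the real power with exponent -1, which agrees with it on
   nonnegative numbers, 0 included. *)
rewrite (_ : (fun x => _) = (fun x => p x `^ (-1))).
  by apply: (measurableT_comp (measurable_powR _)); exact: measurable_pint If.
by apply/funext => x; rewrite powR_inv1//; apply: Rintegral_ge0 => y _.
Qed.

(** Conditional Jensen in the form [(b / p)^2 p = b^2 / p <= c], where [c] is integrable. *)
Lemma cond_score_Lfun : cond_score \in Lfun (marginalX P) 2%:E.
Proof.
have mX2 : measurable_fun [set: X] (fun x => cond_score x ^+ 2).
  by apply: measurable_funX; exact: measurable_cond_score.
apply: integrable_sqr_Lfun; first exact: measurable_cond_score.
apply/(density_integrableP (is_density_marginalX Pf) mX2).
apply: ae_le_integrable (integrable_pint Issf).
- by apply: measurable_funM => //; exact: measurable_pint If.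
- move=> x; rewrite mulr_ge0 ?sqr_ge0//.
  by apply: Rintegral_ge0 => y _.
apply: filterS score_section_ae => x [p0 c0 bpc pc].
rewrite /cond_score -/p -/c; have [px0|pxn0] := eqVneq (p x) 0.
  by rewrite px0 mulr0.
have pp : 0 < p x by rewrite lt_neqAle eq_sym pxn0.
have -> : (b x / p x) ^+ 2 * p x = b x ^+ 2 / p x by field.
by rewrite ler_pdivrMr// mulrC.
Qed.

(** By Fubini both sides are the integral of [u b] against [muX]. This is the only property of the
    marginal score that the final projection argument uses. *)
Lemma cond_score_adjoint (u : X -> R) : u \in Lfun (marginalX P) 2%:E ->
  L2dot P s (u \o fst) = L2dot (marginalX P) cond_score u.
Proof.
move=> uL; have mu_ := Lfun2_measurable uL.
have mu1 : measurable_fun [set: Z] (u \o fst) by exact: measurableT_comp.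
have msu : measurable_fun [set: Z] (fun z => s z * u z.1) by exact: measurable_funM.
have Isu : P.-integrable [set: Z] (EFin \o (fun z => s z * u z.1)).
  apply: integrable_mul_sqr => //; first exact: Lfun2_integrable_sqr.
  exact: (Lfun2_integrable_sqr (Lfun2_comp_fst uL)).
have Iusf : mu.-integrable [set: Z] (EFin \o (fun z => u z.1 * (s z * f z))).
  have /(density_integrableP (mu := sfmu) Pf msu) := Isu.
  by apply: eq_integrable => // z _ /=; congr EFin; ring.
rewrite /L2dot unlock /=.
rewrite [LHS](density_integral (mu := sfmu) Pf msu).
rewrite (density_integral (is_density_marginalX Pf)); last first.
  by apply: measurable_funM => //; exact: measurable_cond_score.
rewrite (eq_integral (fun z => (u z.1 * (s z * f z))%:E)); last first.
  by move=> z _ /=; congr EFin; ring.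
rewrite -[LHS](integral_pint Iusf); apply: ae_eq_integral => //.
- by apply/measurable_EFinP; exact: measurable_pint Iusf.
- apply/measurable_EFinP; apply: measurable_funM; last exact: measurable_pint If.
  by apply: measurable_funM => //; exact: measurable_cond_score.
apply: filterS2 (pint_fst u Isf) cond_scoreM_ae => x -> Hx _.
by rewrite -/b -Hx; congr EFin; rewrite /p; ring.
Qed.

End score.

End marginal_score.

(** * Differentiability in quadratic mean of the marginal family *)

Section marginal_dqm.
Context d1 d2 (X : measurableType d1) (Y : measurableType d2) (R : realType).
Variables (muX : {sigma_finite_measure set X -> \bar R})
  (muY : {sigma_finite_measure set Y -> \bar R}).
Local Notation Z := (X * Y)%type.
Local Notation mu := (muX \x muY)%E.
Local Notation sfmu := (sigma_finite_prod muX muY).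
Local Notation pint := (pint muY).

Lemma measurable_sqrt_remainder (p b c : X -> R) (h : R) :
  measurable_fun [set: X] p -> measurable_fun [set: X] b ->
  measurable_fun [set: X] c -> (forall x, 0 <= p x) ->
  measurable_fun [set: X] (fun x => sqrt_remainder (p x) (b x) (c x) h).
Proof.
move=> mp mb mc p0; rewrite /sqrt_remainder; apply: measurable_funB.
  apply: measurable_funB; last first.
    by apply: measurableT_comp => //; exact: measurable_sqrtr.
  apply: (measurableT_comp (@measurable_sqrtr R)).
  by apply: measurable_funD; [apply: measurable_funD => //|]; exact: measurable_funM.
apply: measurable_funM; last by apply: (measurableT_comp (@measurable_sqrtr R)).
apply: measurable_funM => //; apply: measurable_funM => //.
rewrite (_ : (fun x => _) = (fun x => p x `^ (-1))).
  exact: (measurableT_comp (measurable_powR _)).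
by apply/funext => x; rewrite powR_inv1.
Qed.

(** Dominated convergence with two bounds: after division by [h^2], the bound [h^2 c^2 / (64 p)]
    gives convergence to 0 at almost every [x], but [c^2 / p] may fail to be integrable; the
    domination is by [c]. *)
Lemma sqrt_remainder_integral_cvg0 (p b c : X -> R) (t0 : R) :
  measurable_fun [set: X] p -> measurable_fun [set: X] b ->
  (forall x, 0 <= p x) -> muX.-integrable [set: X] (EFin \o c) ->
  {ae muX, forall x,
    [/\ 0 <= p x, 0 <= c x, b x ^+ 2 <= p x * c x & p x = 0 -> c x = 0]} ->
  (\int[muX]_x ((t - t0) ^- 2 *
     sqrt_remainder (p x) (b x) (c x) (t - t0) ^+ 2)%:E)%E @[t --> t0] --> 0%E.
Proof.
move=> mp mb p0 Ic H.
have mc : measurable_fun [set: X] c by apply/measurable_EFinP; exact: measurable_int Ic.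
pose k h x := h ^- 2 * sqrt_remainder (p x) (b x) (c x) h ^+ 2.
have mk h : measurable_fun [set: X] (k h).
  apply: measurable_funM => //; apply: measurable_funX.
  exact: measurable_sqrt_remainder.
have k0 h x : 0 <= k h x by rewrite mulr_ge0 ?sqr_ge0// invr_ge0 sqr_ge0.
have kc : {ae muX, forall x, forall h, k h x <= c x}.
  apply: filterS H => x [px cx bpc _] h; rewrite /k mulrC.
  (* At [h = 0] the default [0^-1 = 0] makes [k] vanish, so the limit can be taken over a full
     neighbourhood of [t0]. *)
  have [->|h0] := eqVneq h 0; first by rewrite expr0n/= invr0 mulr0.
  rewrite ler_pdivrMr ?exprn_even_gt0//= mulrC.
  exact: sqrt_remainder_dom.
have kb : {ae muX, forall x, forall h, k h x <= h ^+ 2 * (c x ^+ 2 / (64 * p x))}.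
  apply: filterS H => x [px cx bpc pc] h; rewrite /k mulrC.
  have [->|h0] := eqVneq h 0; first by rewrite !expr0n/= invr0 mulr0 mul0r.
  rewrite ler_pdivrMr ?exprn_even_gt0//=.
  apply: (le_trans (sqrt_remainder_bound h px cx bpc pc)).
  by rewrite [leRHS]mulrAC -exprD.
have Ik h : muX.-integrable [set: X] (EFin \o k h).
  by apply: ae_le_integrable Ic => //; apply: filterS kc => x; exact.
suff G : (\int[muX]_x k (t - t0) x)%R @[t --> t0] --> (0 : R).
  apply: cvg_EFin; last exact: G.
  by apply: nearW => t; exact: integrable_fin_num (Ik _).
(* Dominated convergence concerns sequences, so the limit in [t] is tested along every sequence
   tending to [t0]. *)
apply/(@cvg_nbhsP _ R^o) => u ut0.
have u0 : (fun n => (u n - t0) ^+ 2) @ \oo --> (0 : R).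
  rewrite (_ : 0 = (t0 - t0) ^+ 2 :> R); last by rewrite subrr expr0n.
  by apply: cvgM; apply: cvgB => //; exact: cvg_cst.
have kcvg : {ae muX, forall x, [set: X] x ->
    (k (u n - t0) x)%:E @[n --> \oo] --> 0%:E}.
  apply: filterS kb => x kbx _; apply: cvg_EFin; first exact: nearW.
  apply: (@squeeze_cvgr _ _ _ _ (cst 0)
    (fun n => (u n - t0) ^+ 2 * (c x ^+ 2 / (64 * p x)))).
  - by apply: nearW => n /=; rewrite k0 kbx.
  - exact: cvg_cst.
  - rewrite -(mul0r (c x ^+ 2 / (64 * p x))).
    exact: cvgMr_tmp.
have kdom : {ae muX, forall x n, [set: X] x -> (`|(k (u n - t0) x)%:E| <= (c x)%:E)%E}.
  by apply: filterS kc => x kcx n _; rewrite gee0_abs ?lee_fin.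
have [_ _] := @dominated_convergence _ _ _ muX _ measurableT
  (fun n x => (k (u n - t0) x)%:E) (cst 0%:E) (EFin \o c)
  (fun n => measurable_int _ (Ik _)) (measurable_cst _) kcvg Ic kdom.
by rewrite integral_cst// mul0e => /fine_cvgP[].
Qed.

(** The witness is [cond_score]. Integrating the sectionwise linearisation over [x], with Tonelli,
    bounds the marginal error by twice the joint error plus twice the integrated [sqrt_remainder];
    both are negligible. *)
Lemma marginal_dqm (T : set R) (t0 : R) (P : R -> probability Z R) (s : Z -> R) :
  nbhs t0 T -> dqm mu T t0 P s ->
  exists sX, dqm muX T t0 (fun t => marginalX (P t)) sX /\
    forall u, u \in Lfun (marginalX (P t0)) 2%:E ->
      L2dot (P t0) s (u \o fst) = L2dot (marginalX (P t0)) sX u.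
Proof.
move=> nT [sL [f [fd cv]]]; have Tt0 := nbhs_singleton nT.
have fd0 := fd _ Tt0.
have mf t : T t -> measurable_fun [set: Z] (f t) by move=> /fd[].
have f0 t z : T t -> 0 <= f t z by move=> /fd[].
have ms := Lfun2_measurable sL.
pose sX := cond_score muY (f t0) s.
exists sX; split; last by move=> u; exact: (cond_score_adjoint fd0 sL).
split; first exact: (cond_score_Lfun fd0 sL).
exists (fun t => pint (f t)); split.
  by move=> t /fd; exact: is_density_marginalX.
have Issf : mu.-integrable [set: Z] (EFin \o (fun z => s z ^+ 2 * f t0 z)).
  have ms2 : measurable_fun [set: Z] (fun z => s z ^+ 2) by exact: measurable_funX.
  apply/(density_integrableP (mu := sfmu) fd0 ms2).
  exact: Lfun2_integrable_sqr sL.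
have If t : T t -> mu.-integrable [set: Z] (EFin \o f t).
  by move=> /fd; exact: (density_integrable (mu := sfmu)).
have Isf : mu.-integrable [set: Z] (EFin \o (fun z => s z * f t0 z)).
  exact: (integrable_mul_density (mf _ Tt0) ms (fun z => f0 _ z Tt0) (If _ Tt0) Issf).
pose p := pint (f t0).
pose b := pint (fun z => s z * f t0 z).
pose c := pint (fun z => s z ^+ 2 * f t0 z).
have mp : measurable_fun [set: X] p by exact: measurable_pint (If _ Tt0).
have mb : measurable_fun [set: X] b by exact: measurable_pint Isf.
have mc : measurable_fun [set: X] c by exact: measurable_pint Issf.
have p0 x : 0 <= p x by apply: Rintegral_ge0 => y _; exact: f0.
have Hpbc := score_section_ae fd0 sL.
pose rem t x := sqrt_remainder (p x) (b x) (c x) (t - t0) ^+ 2.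
pose S t := (\int[muX]_x ((t - t0) ^- 2 * rem t x)%:E)%E.
have S0 : S t @[t --> t0] --> 0%E.
  exact: sqrt_remainder_integral_cvg0 mp mb p0 (integrable_pint Issf) Hpbc.
pose g t z := (Num.sqrt (f t z) - Num.sqrt (f t0 z)
         - (t - t0) / 2 * s z * Num.sqrt (f t0 z)) ^+ 2.
pose D t := (\int[mu]_z (g t z)%:E)%E.
pose G t x := (Num.sqrt (pint (f t) x) - Num.sqrt (p x)
         - (t - t0) / 2 * sX x * Num.sqrt (p x)) ^+ 2.
have main t : T t -> (((t - t0) ^- 2)%:E * \int[muX]_x (G t x)%:E <=
    2%:E * (((t - t0) ^- 2)%:E * D t) + 2%:E * S t)%E.
  move=> Tt; pose h := t - t0.
  have h0 : 0 <= h ^- 2 by rewrite invr_ge0 sqr_ge0.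
  have mg : measurable_fun [set: Z] (EFin \o g t).
    apply/measurable_EFinP; apply: measurable_funX; apply: measurable_funB.
      by apply: measurable_funB; apply: (measurableT_comp (@measurable_sqrtr R));
        exact: mf.
    apply: measurable_funM; first exact: measurable_funM.
    by apply: (measurableT_comp (@measurable_sqrtr R)); exact: mf.
  have g0 z : (0 <= (EFin \o g t) z)%E by rewrite lee_fin sqr_ge0.
  have mF := @measurable_fun_fubini_tonelli_F _ _ X Y R muY _ mg g0.
  have F0 x : (0 <= fubini_F muY (EFin \o g t) x)%E by exact: integral_ge0.
  have mG : measurable_fun [set: X] (G t).
    apply: measurable_funX; apply: measurable_funB.
      apply: measurable_funB; apply: (measurableT_comp (@measurable_sqrtr R)) => //.
      exact: measurable_pint (If _ Tt).
    apply: measurable_funM; last exact: (measurableT_comp (@measurable_sqrtr R)).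
    by apply: measurable_funM => //; exact: measurable_cond_score fd0 sL.
  have mrem : measurable_fun [set: X] (rem t).
    by apply: measurable_funX; exact: measurable_sqrt_remainder.
  have rem0 x : (0 <= (rem t x)%:E)%E by rewrite lee_fin sqr_ge0.
  have two0 : (0 <= 2%:E :> \bar R)%E by rewrite lee_fin.
  have le : (\int[muX]_x (G t x)%:E <=
      2%:E * D t + 2%:E * \int[muX]_x (rem t x)%:E)%E.
    rewrite /D (fubini_tonelli1 _ mg g0).
    rewrite -!ge0_integralZl_EFin//; last exact/measurable_EFinP.
    rewrite -ge0_integralD//; last 4 first.
    - by move=> x _; exact: mule_ge0.
    - exact: measurable_funeM.
    - by move=> x _; exact: mule_ge0.
    - by apply: measurable_funeM; exact/measurable_EFinP.
    apply: ae_ge0_le_integral => //.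
    - by move=> x _; rewrite lee_fin sqr_ge0.
    - exact/measurable_EFinP.
    - by move=> x _; apply: adde_ge0; exact: mule_ge0.
    - by apply: emeasurable_funD; apply: measurable_funeM => //; exact/measurable_EFinP.
    have := integrable_section_ae Issf.
    apply: filterS3 (integrable_section_ae (If _ Tt)) (integrable_section_ae (If _ Tt0)).
    move=> x Itx I0x Isx _.
    have mfx t' : T t' -> measurable_fun [set: Y] (fun y => f t' (x, y)).
      by move=> /mf mft; exact: measurableT_comp.
    have msx : measurable_fun [set: Y] (fun y => s (x, y)) by exact: measurableT_comp.
    have [Igx H] := sqrt_Rintegral_linearization (mfx _ Tt0) msx
      (fun y => f0 _ (x, y) Tt0) I0x Isx h (mfx _ Tt)
      (fun y => f0 _ (x, y) Tt) Itx.
    have -> : fubini_F muY (EFin \o g t) x = (pint (g t) x)%:E.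
      by rewrite /pint /Rintegral fineK//; exact: (integrable_fin_num measurableT Igx).
    by rewrite -!EFinM -EFinD lee_fin; exact: H.
  have -> : S t = ((h ^- 2)%:E * \int[muX]_x (rem t x)%:E)%E.
    rewrite /S; under eq_integral do rewrite EFinM.
    by rewrite ge0_integralZl_EFin//; exact/measurable_EFinP.
  rewrite ![(2%:E * (_ * _))%E]muleCA -ge0_muleDr ?lee_wpmul2l//.
  - by apply: mule_ge0 => //; apply: integral_ge0 => z _; exact: g0.
  - by apply: mule_ge0 => //; apply: integral_ge0 => x _; exact: rem0.
apply: (@squeeze_cvge _ _ _ _ (cst 0%E) _
    (fun t => 2%:E * (((t - t0) ^- 2)%:E * D t) + 2%:E * S t)%E).
- have : \forall t \near t0^', T t by exact: cvg_within.
  apply: filterS => t Tt; rewrite main// andbT.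
  by rewrite mule_ge0 ?lee_fin ?invr_ge0 ?sqr_ge0// integral_ge0// => x _;
    rewrite lee_fin sqr_ge0.
- exact: cvg_cst.
- rewrite -(adde0 0%E) -[X in (X + _)%E](mule0 2%:E) -[X in (_ + X)%E](mule0 2%:E).
  apply: cvgeD; first by rewrite mule0.
    by apply: cvgeZl.
  by apply: cvgeZl => //; exact: cvg_within_filter S0.
Qed.

End marginal_dqm.

(** * Laws that agree on measurable sets *)

Section eq_on_measurable.
Context d (U : measurableType d) (R : realType)
  (nu : {sigma_finite_measure set U -> \bar R}).

Lemma Lfun2_eq_measure (P Q : probability U R) (u : U -> R) :
  (forall A, measurable A -> P A = Q A) ->
  u \in Lfun P 2%:E -> u \in Lfun Q 2%:E.
Proof.
move=> PQ uL; have mu_ := Lfun2_measurable uL.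
apply: integrable_sqr_Lfun => //.
have /integrableP[mu2 I] := Lfun2_integrable_sqr uL.
apply/integrableP; split => //; apply: le_lt_trans I.
by rewrite (@eq_measure_integral _ _ _ _ P)// => A mA _; exact/esym/PQ.
Qed.

(** Laws are functions on all sets, and [marginalX (joint PX k)] is identified with [PX] on
    measurable sets only; this transports differentiability between the two. *)
Lemma dqm_eq_measure (T : set R) (t0 : R) (P Q : R -> probability U R)
    (s : U -> R) : T t0 ->
  (forall t, T t -> forall A, measurable A -> P t A = Q t A) ->
  dqm nu T t0 P s -> dqm nu T t0 Q s.
Proof.
move=> Tt0 PQ [sL [f [fd cv]]]; split; first exact: Lfun2_eq_measure (PQ _ Tt0) sL.
exists f; split => // t Tt; have [mf f0 fE] := fd _ Tt.
by split => // A mA; rewrite -PQ// fE.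
Qed.

End eq_on_measurable.

(** * Joint densities and their disintegration *)

Section joint_law.
Context d1 d2 (X : measurableType d1) (Y : measurableType d2) (R : realType).
Variables (muX : {sigma_finite_measure set X -> \bar R})
  (muY : {sigma_finite_measure set Y -> \bar R}).
Local Notation Z := (X * Y)%type.
Local Notation mu := (muX \x muY)%E.
Local Notation sfmu := (sigma_finite_prod muX muY).
Local Notation pint := (pint muY).

Variable k : R.-pker X ~> Y.

Lemma measurable_kernel_section (A : set Z) : measurable A ->
  measurable_fun [set: X] (fun x => k x (xsection A x)).
Proof. by move=> mA; exact: (measurable_fun_xsection_finite_kernel k (mem_set mA)). Qed.

Lemma jointI_fst (PX : probability X R) (A : set Z) (E : set X) :
  joint PX k (A `&` fst @^-1` E) =
  (\int[PX]_x ((\1_E x)%:E * k x (xsection A x)))%E.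
Proof.
apply: eq_integral => x _; rewrite !xsectionE preimage_setI -comp_preimage.
rewrite [X in _ `&` X](_ : _ = [set y | E x])//.
have [Ex|Ex] := pselect (E x); rewrite indicE.
  rewrite mem_set// mul1e (_ : [set y | E x] = setT) ?setIT//.
  by apply/seteqP; split.
rewrite memNset// mul0e (_ : [set y | E x] = set0) ?setI0 ?measure0//.
by apply/seteqP; split.
Qed.

Lemma marginalX_joint (PX : probability X R) (A : set X) :
  measurable A -> marginalX (joint PX k) A = PX A.
Proof.
move=> mA; rewrite -[LHS]/(joint PX k (fst @^-1` A)) -[fst @^-1` A]setTI jointI_fst.
rewrite -[A in RHS]setIT -(integral_indic PX measurableT mA).
apply: eq_integral => x _.
by rewrite xsectionE preimage_setT prob_kernel mule1.
Qed.

Hypothesis kmuY : forall x, k x `<< muY.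

(** A null set of the product has [muY]-null sections at [muX]-almost every [x], hence at
    [PX]-almost every [x], and [k x] does not charge them. *)
Lemma joint_dominates (PX : probability X R) :
  PX `<< muX -> joint PX k `<< sfmu.
Proof.
move=> PXmu; apply/null_content_dominatesP => A mA.
rewrite -[LHS]/(\int[muX]_x muY (xsection A x))%E => A0.
have mS : measurable_fun [set: X] (fun x => muY (xsection A x)).
  exact: measurable_fun_xsection.
have : ae_eq muX setT (fun x => muY (xsection A x)) (cst 0%E).
  apply/ae_eq_integral_abs => //.
  by under eq_integral do rewrite gee0_abs//.
move/(null_dominates_ae_eq measurableT PXmu) => H.
rewrite -[LHS]/(\int[PX]_x k x (xsection A x))%E.
rewrite (@ae_eq_integral _ _ _ _ _ (cst 0%E))// ?integral0//.
  exact: measurable_kernel_section.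
apply: filterS H => x /(_ I) Ax0 _.
have /null_content_dominatesP := kmuY x; apply => //.
exact: measurable_xsection.
Qed.

(** Radon-Nikodym is applied to the joint law: densities of the [k x] picked one [x] at a time could
    fail to be jointly measurable. *)
Lemma joint_has_density (PX : probability X R) :
  PX `<< muX -> exists r, is_density mu (joint PX k) r.
Proof.
move=> /joint_dominates D.
pose r := Radon_Nikodym_SigmaFinite.f (joint PX k) sfmu.
exists (fine \o r); split.
- apply: (measurableT_comp (fine_measurable measurableT)).
  exact: measurable_int _ (Radon_Nikodym_SigmaFinite.f_integrable D).
- by move=> z; apply: fine_ge0; exact: Radon_Nikodym_SigmaFinite.f_ge0.
move=> A mA.
rewrite -[LHS]/((joint PX k : {finite_measure set Z -> \bar R}) A).
rewrite (Radon_Nikodym_SigmaFinite.f_integral D mA).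
apply: eq_integral => z _; rewrite /= fineK//.
exact: Radon_Nikodym_SigmaFinite.f_fin_num.
Qed.

(** Over any measurable [E] both sides integrate to the joint mass of the part of [A] above [E]. The
    exceptional null set may depend on [A], so the lemma is applied to one [A] at a time. *)
Lemma joint_density_section_ae (PX : probability X R) (p : X -> R) (r : Z -> R)
    (A : set Z) :
  is_density muX PX p -> is_density mu (joint PX k) r -> measurable A ->
  {ae muX, forall x, (\int[muY]_y (r (x, y) * \1_A (x, y))%:E =
                      (p x)%:E * k x (xsection A x))%E}.
Proof.
move=> pd rd mA; have [mp p0 pE] := pd; have [mr r0 rE] := rd.
have Ir := density_integrable (mu := sfmu) rd.
have Ig : mu.-integrable [set: Z] (EFin \o (fun z => r z * \1_A z)).
  apply: ae_le_integrable Ir.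
  - exact: measurable_funM.
  - by move=> z; rewrite mulr_ge0.
  - by apply: aeW => z; rewrite indicE ler_piMr// lern1 leq_b1.
have : ae_eq muX setT (EFin \o pint (fun z => r z * \1_A z))
    (fun x => (p x)%:E * k x (xsection A x))%E.
  apply: integral_ae_eq => //.
  - exact: integrable_pint.
  - apply: emeasurable_funM; first exact/measurable_EFinP.
    exact: measurable_kernel_section.
  move=> E _ mE.
  have mE' : measurable (A `&` fst @^-1` E : set Z).
    by apply: measurableI => //; rewrite -[X in measurable X]setTI; exact: measurable_fst.
  have mkA := measurable_kernel_section mA.
  have m1E : measurable_fun [set: X] (fun x => (\1_E x : R)%:E).
    by apply/measurable_EFinP; exact: measurable_indic.
  have Ih : mu.-integrable [set: Z] (EFin \o (fun z => \1_E z.1 * (r z * \1_A z))).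
    apply: ae_le_integrable Ig.
    - apply: measurable_funM; last exact: measurable_funM.
      by apply: measurableT_comp => //; exact: measurable_indic.
    - by move=> z; rewrite mulr_ge0// mulr_ge0.
    - apply: aeW => z; apply: ler_piMl; first exact: mulr_ge0.
      by rewrite indicE lern1 leq_b1.
  transitivity (joint PX k (A `&` fst @^-1` E)).
    rewrite rE// integral_mkcond [RHS]integral_mkcond.
    transitivity (\int[muX]_x (pint (fun z => \1_E z.1 * (r z * \1_A z)) x)%:E)%E.
      apply: ae_eq_integral => //.
      - apply/(measurable_restrictT _ mE)/measurable_funTS/measurable_EFinP.
        exact: measurable_pint Ig.
      - by apply/measurable_EFinP; exact: measurable_pint Ih.
      apply: filterS (pint_fst \1_E Ig) => x -> _.
      by rewrite epatch_indic EFinM muleC.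
    rewrite (integral_pint Ih); apply: eq_integral => z _.
    rewrite epatch_indic/= indicI/= -EFinM; congr EFin.
    by rewrite mulrCA; congr (_ * _); rewrite mulrC.
  rewrite jointI_fst (density_ge0_integral pd); first last.
  - by move=> x; rewrite mule_ge0// lee_fin.
  - exact: emeasurable_funM.
  rewrite [RHS]integral_mkcond; apply: eq_integral => x _.
  by rewrite epatch_indic/= -muleA [RHS]muleC; congr (_ * _)%E; rewrite muleC.
apply: filterS2 (integrable_section_ae Ig) => x Igx /(_ I) <-.
by rewrite /= /pint /Rintegral fineK//; exact: (integrable_fin_num measurableT Igx).
Qed.

End joint_law.

(** * Lifting a marginal family along a fixed conditional law *)

Section dqm_joint.
Context d1 d2 (X : measurableType d1) (Y : measurableType d2) (R : realType).
Variables (muX : {sigma_finite_measure set X -> \bar R})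
  (muY : {sigma_finite_measure set Y -> \bar R}).
Local Notation Z := (X * Y)%type.
Local Notation mu := (muX \x muY)%E.
Variable k : R.-pker X ~> Y.
Hypothesis kmuY : forall x, k x `<< muY.

Section density.
Variables (Q Q0 : probability X R) (p p0 : X -> R) (r r0 : Z -> R).
Hypotheses (pd : is_density muX Q p) (p0d : is_density muX Q0 p0).
Hypotheses (rd : is_density mu (joint Q k) r) (r0d : is_density mu (joint Q0 k) r0).
Variable e : bool.
Hypothesis eP : e = false -> p = p0.

(* On [p0 > 0] the conditional density is [r0 / p0]; there is no such formula on
   [p0 = 0], where [r] is used. The flag [e] erases this second part at the base
   point of the model. *)
Definition lift_density (z : Z) : R :=
  p z.1 / p0 z.1 * r0 z + e%:R * (p0 z.1 == 0)%:R * r z.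

Lemma lift_density_pos x y : p0 x != 0 ->
  lift_density (x, y) = p x / p0 x * r0 (x, y).
Proof. by move=> /negbTE h; rewrite /lift_density/= h mulr0 mul0r addr0. Qed.

Lemma lift_density_zero x y : p0 x = 0 ->
  lift_density (x, y) = e%:R * r (x, y).
Proof.
by move=> h; rewrite /lift_density/= h eqxx invr0 mulr0 mul0r add0r mulr1.
Qed.

(** For fixed [A], the section of [r0] has mass [p0 x * k x A_x], which the factor [p / p0] turns
    into [p x * k x A_x]. Where [p0 = 0], [r] supplies this mass; if the flag is off, [p = p0] and
    the mass is 0 there. *)
Lemma is_density_lift : is_density mu (joint Q k) lift_density.
Proof.
have [mp p_ge0 pE] := pd; have [mp0 p0_ge0 p0E] := p0d.
have [mr r_ge0 rE] := rd; have [mr0 r0_ge0 r0E] := r0d.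
have mq : measurable_fun [set: Z] lift_density.
  apply: measurable_funD.
    apply: measurable_funM => //; apply: measurable_funM.
      exact: measurableT_comp.
    rewrite (_ : (fun z => _) = (fun z : Z => p0 z.1 `^ (-1))).
      apply: (measurableT_comp (measurable_powR _)).
      exact: measurableT_comp.
    by apply/funext => z; rewrite powR_inv1.
  apply: measurable_funM => //; apply: measurable_funM => //.
  rewrite (_ : (fun z => _) = (\1_(p0 @^-1` [set 0]) \o fst)); last first.
    apply/funext => z; rewrite /= indicE; congr (nat_of_bool _)%:R.
    by apply/eqP/idP; rewrite inE.
  apply: (@measurableT_comp _ _ _ _ _ _ (\1_(p0 @^-1` [set 0]) : X -> R)) => //.
  apply: measurable_indic; rewrite -[X in measurable X]setTI.
  exact: mp0.
have q_ge0 z : 0 <= lift_density z.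
  by rewrite addr_ge0// mulr_ge0// ?mulr_ge0// ?invr_ge0.
split => // A mA; rewrite integral_mkcond.
have mqA : measurable_fun [set: Z] (EFin \o (fun z => lift_density z * \1_A z)).
  by apply/measurable_EFinP; exact: measurable_funM.
have qA0 z : (0 <= (EFin \o (fun z => lift_density z * \1_A z)%R) z)%E.
  by rewrite lee_fin mulr_ge0.
rewrite (_ : (_ \_ A)%E = EFin \o (fun z => lift_density z * \1_A z)); last first.
  by rewrite epatch_indic.
rewrite (fubini_tonelli1 _ mqA qA0).
rewrite -[LHS]/(\int[Q]_x k x (xsection A x))%E (density_ge0_integral pd)//; last first.
  exact: measurable_kernel_section.
apply: ae_eq_integral => //.
- apply: emeasurable_funM; first exact: measurable_kernel_section.
  exact/measurable_EFinP.
- exact: (@measurable_fun_fubini_tonelli_F _ _ X Y R muY _ mqA qA0).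
apply: filterS2 (joint_density_section_ae pd rd mA) (joint_density_section_ae p0d r0d mA).
move=> x Hr Hr0 _; rewrite muleC /fubini_F.
have msec (g : Z -> R) : measurable_fun [set: Z] g ->
    measurable_fun [set: Y] (fun y => (g (x, y) * \1_A (x, y))%:E).
  move=> mg; apply/measurable_EFinP.
  by apply: (@measurableT_comp _ _ _ _ _ _ (fun z => g z * \1_A z)) => //;
    exact: measurable_funM.
have [px0|px0] := eqVneq (p0 x) 0.
  under eq_integral do rewrite /= lift_density_zero// -mulrA EFinM.
  rewrite ge0_integralZl_EFin//.
  - rewrite Hr; move: eP; case: (e) => /=; first by rewrite mul1e.
    by move=> /(_ erefl) ->; rewrite px0 !mul0e.
  - by move=> y _; rewrite lee_fin mulr_ge0.
  - exact: msec.
under eq_integral do rewrite /= lift_density_pos// -mulrA EFinM.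
rewrite ge0_integralZl_EFin//.
- by rewrite Hr0 muleA -EFinM divfK.
- by move=> y _; rewrite lee_fin mulr_ge0.
- exact: msec.
- by rewrite divr_ge0.
Qed.

End density.

(** The two quadratic-mean errors are equal for each [t]. Where [p t0 > 0], the joint integrand is a
    function of [x] times [r t0], whose section integrates to [p t0 x]. Where [p t0 = 0], the base
    density and the score term vanish, and both sides reduce to [p t x]. *)
Lemma dqm_joint (T : set R) (t0 : R) (Q : R -> probability X R) (sX : X -> R) :
  nbhs t0 T -> dqm muX T t0 Q sX ->
  dqm mu T t0 (fun t => joint (Q t) k) (sX \o fst).
Proof.
move=> nT [sL [p [pd cv]]]; have Tt0 := nbhs_singleton nT; split.
  apply: Lfun2_comp_fst; apply: Lfun2_eq_measure sL => A mA.
  exact/esym/marginalX_joint.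
have rex t : exists rt, T t -> is_density mu (joint (Q t) k) rt.
  have [Tt|nTt] := pselect (T t); last by exists (cst 0).
  have [rt H] := joint_has_density kmuY (density_dominates (pd _ Tt)).
  by exists rt.
have [r rd] := choice rex.
pose e t := t != t0.
have eP t : e t = false -> p t = p t0 by move=> /negbFE/eqP ->.
pose q t := lift_density (p t) (p t0) (r t) (r t0) (e t).
have qd t : T t -> is_density mu (joint (Q t) k) (q t).
  move=> Tt; apply: (is_density_lift (pd _ Tt) (pd _ Tt0) (rd _ Tt) (rd _ Tt0)).
  exact: eP.
exists q; split => //.
suff main t : T t ->
    (\int[mu]_z ((Num.sqrt (q t z) - Num.sqrt (q t0 z)
       - (t - t0) / 2 * (sX \o fst) z * Num.sqrt (q t0 z)) ^+ 2)%:E =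
     \int[muX]_x ((Num.sqrt (p t x) - Num.sqrt (p t0 x)
       - (t - t0) / 2 * sX x * Num.sqrt (p t0 x)) ^+ 2)%:E)%E.
  apply: cvg_trans cv; apply: near_eq_cvg.
  have : \forall t \near t0^', T t by exact: cvg_within.
  by apply: filterS => t Tt /=; rewrite main.
move=> Tt; set h := (t - t0) / 2.
have msX := Lfun2_measurable sL.
have [mpt pt_ge0 _] := pd _ Tt; have [mp0 p0_ge0 _] := pd _ Tt0.
have [mrt rt_ge0 _] := rd _ Tt; have [mr0 r0_ge0 _] := rd _ Tt0.
have [mqt _ _] := qd _ Tt; have [mq0 _ _] := qd _ Tt0.
pose g z := (Num.sqrt (q t z) - Num.sqrt (q t0 z)
       - h * (sX \o fst) z * Num.sqrt (q t0 z)) ^+ 2.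
have mg : measurable_fun [set: Z] (EFin \o g).
  apply/measurable_EFinP; apply: measurable_funX; apply: measurable_funB.
    by apply: measurable_funB; exact: (measurableT_comp (@measurable_sqrtr R)).
  apply: measurable_funM; last exact: (measurableT_comp (@measurable_sqrtr R)).
  by apply: measurable_funM => //; exact: measurableT_comp.
have g0 z : (0 <= (EFin \o g) z)%E by rewrite lee_fin sqr_ge0.
rewrite (fubini_tonelli1 _ mg g0); apply: ae_eq_integral => //.
- exact: (@measurable_fun_fubini_tonelli_F _ _ X Y R muY _ mg g0).
- apply/measurable_EFinP; apply: measurable_funX; apply: measurable_funB.
    by apply: measurable_funB; exact: (measurableT_comp (@measurable_sqrtr R)).
  apply: measurable_funM; last exact: (measurableT_comp (@measurable_sqrtr R)).
  exact: measurable_funM.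
have section_mass s : T s ->
    {ae muX, forall x, (\int[muY]_y (r s (x, y))%:E = (p s x)%:E)%E}.
  move=> Ts; have := joint_density_section_ae (pd _ Ts) (rd _ Ts) measurableT.
  apply: filterS => x; rewrite xsectionE preimage_setT prob_kernel mule1 => <-.
  by apply: eq_integral => y _; rewrite indicT mulr1.
apply: filterS2 (section_mass _ Tt) (section_mass _ Tt0) => x Ht H0 _.
have msec (u : Z -> R) : measurable_fun [set: Z] u ->
    measurable_fun [set: Y] (fun y => (u (x, y))%:E).
  by move=> mu_; apply/measurable_EFinP; exact: measurableT_comp.
rewrite /fubini_F; have [px0|px0] := eqVneq (p t0 x) 0.
  rewrite (eq_integral (fun y => ((e t)%:R)%:E * (r t (x, y))%:E)%E); last first.
    move=> y _; rewrite /= /g /q !lift_density_zero//= /e eqxx mul0r sqrtr0.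
    by rewrite mulr0 !subr0 sqr_sqrtr ?mulr_ge0// EFinM.
  rewrite ge0_integralZl_EFin//; [|by move=> y _; rewrite lee_fin|exact: msec].
  rewrite Ht px0 sqrtr0 mulr0 !subr0 sqr_sqrtr//.
  by move: (eP t); case: (e t) => [_|->//]; rewrite ?mul1e// px0 mul0e.
have pp : 0 < p t0 x by rewrite lt_neqAle eq_sym px0 p0_ge0.
pose C := (Num.sqrt (p t x / p t0 x) - 1 - h * sX x) ^+ 2.
rewrite (eq_integral (fun y => C%:E * (r t0 (x, y))%:E)%E); last first.
  move=> y _; rewrite /= /g /q !lift_density_pos//= divff// mul1r -EFinM; congr EFin.
  rewrite sqrtrM ?divr_ge0// /C -[r t0 (x, y) in RHS]sqr_sqrtr// -exprMn.
  by congr (_ ^+ 2); ring.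
rewrite ge0_integralZl_EFin ?sqr_ge0//; [|by move=> y _; rewrite lee_fin|exact: msec].
rewrite H0 -EFinM /C; congr EFin.
have -> : Num.sqrt (p t x) = Num.sqrt (p t x / p t0 x) * Num.sqrt (p t0 x).
  by rewrite -sqrtrM ?divr_ge0// divfK.
have p0E : Num.sqrt (p t0 x) ^+ 2 = p t0 x by rewrite sqr_sqrtr.
by rewrite -[X in _ * X = _]p0E -exprMn; congr (_ ^+ 2); ring.
Qed.

End dqm_joint.

(** * The inner product of L^2(P) *)

Section L2dot.
Context d (U : measurableType d) (R : realType).
Variable P : probability U R.
Implicit Types f g : U -> R.

Lemma L2dotE f g : L2dot P f g = (\int[P]_u (f u * g u)%:E)%E.
Proof. by rewrite /L2dot unlock. Qed.

Lemma L2dotC f g : L2dot P f g = L2dot P g f.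
Proof. by rewrite !L2dotE; apply: eq_integral => u _; rewrite mulrC. Qed.

Lemma L2dot0 f : L2dot P f (fun=> 0) = 0%E.
Proof. by rewrite L2dotE; under eq_integral do rewrite mulr0; rewrite integral0. Qed.

Lemma Lfun2_mul_integrable f g : f \in Lfun P 2%:E -> g \in Lfun P 2%:E ->
  P.-integrable [set: U] (EFin \o (fun u => f u * g u)).
Proof.
move=> fL gL; apply: integrable_mul_sqr.
- exact: Lfun2_measurable fL.
- exact: Lfun2_measurable gL.
- exact: Lfun2_integrable_sqr.
- exact: Lfun2_integrable_sqr.
Qed.

Lemma L2dot_fin_num f g : f \in Lfun P 2%:E -> g \in Lfun P 2%:E ->
  L2dot P f g \is a fin_num.
Proof.
move=> fL gL; rewrite L2dotE.
exact: (integrable_fin_num measurableT (Lfun2_mul_integrable fL gL)).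
Qed.

Section sum.
Variables (n : nat) (c : 'I_n -> R) (f : 'I_n -> U -> R).
Hypothesis fL : forall i, f i \in Lfun P 2%:E.

Lemma Lfun2_sum : (fun u => \sum_(i < n) c i * f i u) \in Lfun P 2%:E.
Proof.
have H : \sum_(i < n) (c i \o* f i) \in Lfun P 2%:E.
  have le12 : (1 <= 2%:E :> \bar R)%E by rewrite lee_fin ler1n.
  by apply: rpred_sum => i _; apply: Lfun_scale => //; rewrite ler1n.
rewrite (_ : (fun u => _) = \sum_(i < n) (c i \o* f i))//.
apply/funext => u; rewrite fct_sumE; apply: eq_bigr => i _ /=.
by rewrite mulrC.
Qed.

Lemma L2dot_suml g : g \in Lfun P 2%:E ->
  L2dot P (fun u => \sum_(i < n) c i * f i u) g =
  (\sum_(i < n) (c i)%:E * L2dot P (f i) g)%E.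
Proof.
move=> gL; rewrite L2dotE.
under eq_integral do rewrite mulr_suml -sumEFin.
rewrite (@integral_sum _ _ _ P _ measurableT 'I_n
  (fun i u => (c i * f i u * g u)%:E)); last first.
  move=> i; rewrite (_ : (fun u => _) = EFin \o (fun u => c i * (f i u * g u))).
    by apply: integrable_EFinZl; exact: Lfun2_mul_integrable.
  by apply/funext => u /=; rewrite mulrA.
apply: eq_bigr => i _; under eq_integral do rewrite -mulrA EFinM.
by rewrite (integralZl measurableT (Lfun2_mul_integrable (fL i) gL)) L2dotE.
Qed.

End sum.

(* Nonnegativity of the square norm of [f - g + h]. *)
Lemma L2dot_projection_le f g h :
  f \in Lfun P 2%:E -> g \in Lfun P 2%:E -> h \in Lfun P 2%:E ->
  L2dot P f h = 0%E -> L2dot P g h = L2dot P h h ->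
  (L2dot P h h <= L2dot P (f \- g)%R (f \- g)%R)%E.
Proof.
move=> fL gL hL fh gh.
pose w := f \- g.
have wL : w \in Lfun P 2%:E.
  have le12 : (1 <= 2%:E :> \bar R)%E by rewrite lee_fin ler1n.
  exact: rpredB.
have wh : L2dot P w h = (- L2dot P h h)%E.
  rewrite -gh -[RHS]add0e -fh !L2dotE -integralB//; [|exact: Lfun2_mul_integrable..].
  by apply: eq_integral => u _; rewrite -EFinB -mulrBl.
have hE : L2dot P h h = (\int[P]_u (h u ^+ 2))%:E.
  rewrite L2dotE /Rintegral fineK//.
  exact: (integrable_fin_num measurableT (Lfun2_integrable_sqr hL)).
have wE : L2dot P w w = (\int[P]_u (w u ^+ 2))%:E.
  rewrite L2dotE /Rintegral fineK//.
  exact: (integrable_fin_num measurableT (Lfun2_integrable_sqr wL)).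
have whE : L2dot P w h = (\int[P]_u (w u * h u))%:E.
  rewrite L2dotE /Rintegral fineK//.
  exact: (integrable_fin_num measurableT (Lfun2_mul_integrable wL hL)).
move: wh; rewrite -/w whE hE wE lee_fin => -[wh].
have := Rintegral_sqrrB (Lfun2_measurable wL) (Lfun2_measurable hL)
  (Lfun2_integrable_sqr wL) (Lfun2_integrable_sqr hL) (- 1).
have : 0 <= \int[P]_u ((w u - (- 1) * h u) ^+ 2).
  by apply: Rintegral_ge0 => u _; exact: sqr_ge0.
by rewrite wh => + E; rewrite E; lra.
Qed.

End L2dot.

Lemma is_derive_near_cst (R : realType) (V : normedModType R) (f : R -> V)
    (t : R) (l a : V) :
  is_derive t (1 : R) f l -> (\forall u \near t, f u = a) -> l = 0.
Proof.
move=> [fd <-] fa; rewrite -(derive_cst a t 1).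
by apply: near_eq_derive; exact: fa.
Qed.

(** * Marginal scores and their orthogonality to the gradient *)

Section marginal_scores.
Context (R : realType) (d1 d2 : measure_display)
  (X : measurableType d1) (Y : measurableType d2).
Variables (muX : {sigma_finite_measure set X -> \bar R})
  (muY : {sigma_finite_measure set Y -> \bar R})
  (MX : set (probability X R)) (MYX : set (R.-pker X ~> Y)).
Hypothesis Mdom : dominated_models muX muY MX MYX.
Variables (PXs : probability X R) (ks : R.-pker X ~> Y).
Hypotheses (PXs_in : MX PXs) (ks_in : MYX ks).
Variables (p : nat) (theta : probability (X * Y)%type R -> 'cV[R]_p)
  (phi : X * Y -> 'cV[R]_p).
Hypothesis phi_gradient : gradient muX muY MX MYX theta (joint PXs ks) phi.
Hypothesis theta_ws : well_specified MX theta PXs ks.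

Local Notation Pstar := (joint PXs ks).

Lemma gradient_orthogonal_marginal (T : set R) (t0 : R)
    (P : R -> probability (X * Y)%type R) (sX : X -> R) :
  nbhs t0 T -> (forall t, T t -> model MX MYX (P t)) -> P t0 = Pstar ->
  dqm muX T t0 (fun t => marginalX (P t)) sX ->
  forall i, L2dot Pstar (fun z => phi z i 0) (sX \o fst) = 0%E.
Proof.
move=> nT Pm Pt0 D i; have Tt0 := nbhs_singleton nT.
(* [model] yields a marginal law for each [t] separately. At [t0] the choice must be [PXs] itself,
   so that the new path passes through [Pstar]; outside [T] the value is a default. *)
have Qex t : exists Q : probability X R,
    (T t -> MX Q /\ forall A, measurable A -> marginalX (P t) A = Q A) /\
    (t = t0 -> Q = PXs).
  have [->|tt0] := eqVneq t t0.
    exists PXs; split => // _; split => // A mA.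
    by rewrite Pt0 marginalX_joint.
  have [Tt|nTt] := pselect (T t); last first.
    by exists PXs; split => // Tt; exfalso; exact: nTt.
  have [PX [k [MPX _ Pt]]] := Pm _ Tt.
  exists PX; split; last by move=> tE; rewrite tE eqxx in tt0.
  by move=> _; split => // A mA; rewrite -(marginalX_joint k PX mA)
    -[LHS]/((P t : set _ -> _) (fst @^-1` A)) Pt.
have [Q HQ] := choice Qex.
have Qt0 : Q t0 = PXs by have [_] := HQ t0; exact.
have DQ : dqm muX T t0 Q sX.
  by apply: dqm_eq_measure D => // t Tt; have [/(_ Tt)[]] := HQ t.
have [_ domY] := Mdom; have DJ := dqm_joint (domY _ ks_in) nT DQ.
have SM : submodel muX muY MX MYX Pstar T t0 (fun t => joint (Q t) ks) (sX \o fst).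
  split => //; last by rewrite Qt0.
  move=> t Tt; exists (Q t), ks; split => //.
  by have [/(_ Tt)[]] := HQ t.
have [phiL /(_ _ _ _ _ SM) der] := phi_gradient.
have := is_derive_near_cst der (a := theta Pstar).
have nc : \forall t \near t0, theta (joint (Q t) ks) = theta Pstar.
  apply: filterS nT => t Tt; apply/esym/theta_ws.
  by have [/(_ Tt)[]] := HQ t.
move=> /(_ nc)/colP/(_ i); rewrite !mxE => H.
have sXL : (sX \o fst) \in Lfun Pstar 2%:E by have [] := DJ; rewrite Qt0.
(* The gradient identity controls only the [fine] part, which is 0 for infinite values too; square
   integrability rules these out. *)
have := L2dot_fin_num (phiL i).1 sXL => /fineK <-.
by rewrite H.
Qed.

(** Provides the partner that turns an i.i.d. approximation into an OSS one with the same
    coefficients, together with the two inner-product identities that bound the partner's norm. *)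
Lemma oss_score_of_score (s : X * Y -> R) :
  scores muX muY MX MYX Pstar s ->
  exists sX, [/\ oss_scores muX muY MX MYX Pstar (s, sX),
    s \in Lfun Pstar 2%:E, sX \in Lfun (marginalX Pstar) 2%:E,
    (forall u, u \in Lfun (marginalX Pstar) 2%:E ->
      L2dot Pstar s (u \o fst) = L2dot (marginalX Pstar) sX u) &
    forall i, L2dot Pstar (fun z => phi z i 0) (sX \o fst) = 0%E].
Proof.
move=> [T [t0 [P SM]]]; have [nT Pm Pt0 D] := SM.
have [sX [DX adj]] := marginal_dqm nT D.
exists sX; split.
- by exists T, t0, P; split.
- by have [] := D; rewrite Pt0.
- by have [] := DX; rewrite Pt0.
- by move: adj; rewrite Pt0.
- exact: gradient_orthogonal_marginal DX.
Qed.

End marginal_scores.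

(** * The OSS canonical gradient *)

Theorem corollary4p2 (R : realType) (d1 d2 : measure_display)
    (X : measurableType d1) (Y : measurableType d2)
    (muX : {sigma_finite_measure set X -> \bar R})
    (muY : {sigma_finite_measure set Y -> \bar R})
    (MX : set (probability X R)) (MYX : set (R.-pker X ~> Y))
    (Mdom : dominated_models muX muY MX MYX)
    (PXs : probability X R) (ks : R.-pker X ~> Y)
    (PXs_in : MX PXs) (ks_in : MYX ks)
    (p : nat) (Theta : set 'cV[R]_p)
    (theta : probability (X * Y)%type R -> 'cV[R]_p)
    (theta_in : forall P, model MX MYX P -> Theta (theta P))
    (N : nat -> nat) (gamma : R)
    (gamma_lim : ((N n)%:R / (n + N n)%:R : R) @[n --> \oo] --> gamma)
    (gamma01 : 0 < gamma < 1)
    (phi : X * Y -> 'cV[R]_p)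
    (phi_eif : efficient_influence_function muX muY MX MYX theta
                 (joint PXs ks) phi)
    (theta_ws : well_specified MX theta PXs ks) :
  oss_efficient_influence_function muX muY MX MYX gamma theta (joint PXs ks)
    (fun z1 _ => phi z1).
Proof.
have [[phiL der] tang] := phi_eif; have [g0 g1] := andP gamma01.
have r0 : 0 <= oss_ratio gamma by rewrite divr_ge0 ?subr_ge0 ?ltW.
pose zeroX := (fun=> 0) : X -> 'cV[R]_p.
have zero_L2 : L2_0 (marginalX (joint PXs ks)) (fun=> 0 : R).
  split; last by rewrite -[(fun=> _)]/(cst 0) expectation_cst.
  apply: integrable_sqr_Lfun => //.
  by under eq_fun do rewrite expr0n; exact: integrable0.
have zero_L2v : L2_0v (marginalX (joint PXs ks)) zeroX.
  by move=> i; rewrite (_ : (fun=> _) = fun=> 0)//; apply/funext => x; rewrite mxE.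
exists phi, zeroX; split => //.
  by apply/funext => z; apply/funext => x; rewrite addr0.
(* The same pair serves again: with second component 0, the weight [Num.sqrt (oss_ratio gamma)] of
   the normalisation and the weight [oss_ratio gamma] of H give the same function. *)
exists phi, zeroX; split.
- by apply/funext => z; apply/funext => x; rewrite /oss_fun !scaler0.
- split => // T t0 P s sX SM _; have := der _ _ _ _ SM.
  rewrite (_ : \col_i _ = \col_i fine (Hdot gamma (joint PXs ks) (s, sX)
    (fun z => phi z i 0, fun x => zeroX x i 0)))//.
  apply/colP => i; rewrite !mxE /Hdot/=.
  rewrite (_ : (fun x => zeroX x i 0) = fun=> 0); last first.
    by apply/funext => x; rewrite mxE.
  by rewrite L2dot0 mule0 adde0 L2dotC.
move=> a; have [psiL approx] := tang a.
have zeroE : dotv a zeroX = fun=> 0.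
  by apply/funext => x; rewrite /dotv mulmx0 mxE.
split => //=; first by rewrite zeroE.
(* The second component of the residual has norm at most that of the first, so the squared norm in H
   is at most [1 + oss_ratio gamma] times that of [a^T phi - S]. *)
move=> e e0; have e'0 : 0 < e / (1 + oss_ratio gamma).
  by rewrite divr_gt0// ltr_pwDl.
have [n [c [s [sS he]]]] := approx _ e'0.
have [sX HX] := choice (fun i => oss_score_of_score Mdom PXs_in ks_in
  (conj phiL der) theta_ws (sS i)).
exists n, c, (fun i => (s i, sX i)); split; first by move=> i; have [] := HX i.
move=> /=; rewrite zeroE.
pose S z := \sum_(i < n) c i * s i z; pose SX x := \sum_(i < n) c i * sX i x.
have sL i : s i \in Lfun (joint PXs ks) 2%:E by have [] := HX i.
have sXL i : sX i \in Lfun (marginalX (joint PXs ks)) 2%:E by have [] := HX i.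
have SL : S \in Lfun (joint PXs ks) 2%:E by exact: Lfun2_sum.
have SXL : SX \in Lfun (marginalX (joint PXs ks)) 2%:E by exact: Lfun2_sum.
have VL := Lfun2_comp_fst SXL.
have adj u : u \in Lfun (marginalX (joint PXs ks)) 2%:E ->
    L2dot (joint PXs ks) S (u \o fst) = L2dot (marginalX (joint PXs ks)) SX u.
  move=> uL; rewrite !L2dot_suml//; last exact: Lfun2_comp_fst.
  by apply: eq_bigr => i _; have [_ _ _ ->] := HX i.
have orth : L2dot (joint PXs ks) (dotv a phi) (SX \o fst) = 0%E.
  rewrite (_ : dotv a phi = fun z => \sum_(i < p) a i 0 * phi z i 0); last first.
    by apply/funext => z; rewrite /dotv mxE; apply: eq_bigr => i _; rewrite mxE.
  rewrite L2dot_suml//; last by move=> i; exact: (phiL i).1.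
  apply: big1 => i _; rewrite L2dotC.
  rewrite (_ : SX \o fst = fun z => \sum_(j < n) c j * (sX j \o fst) z)//.
  rewrite L2dot_suml; last 2 first.
  - by move=> j; exact: Lfun2_comp_fst.
  - exact: (phiL i).1.
  rewrite big1 ?mule0// => j _; rewrite L2dotC.
  by have [_ _ _ _ ->] := HX j; rewrite mule0.
have VV : L2dot (joint PXs ks) (SX \o fst) (SX \o fst) =
    L2dot (marginalX (joint PXs ks)) SX SX.
  rewrite !L2dotE ge0_integral_distribution//.
  - apply/measurable_EFinP; apply: measurable_funM; exact: Lfun2_measurable SXL.
  - by move=> x; rewrite lee_fin -expr2 sqr_ge0.
(* Through [VV], [adj] at [u = SX] says that [S - SX \o fst] is orthogonal to [SX \o fst]. *)
have proj := L2dot_projection_le psiL.1 SL VL orth (etrans (adj _ SXL) (esym VV)).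
rewrite /Hdot/=.
rewrite [X in (_ + _ * X)%E](_ : _ = L2dot (joint PXs ks) (SX \o fst) (SX \o fst));
  last first.
  rewrite VV !L2dotE; apply: eq_integral => x _.
  by rewrite sub0r mulrNN.
pose w := dotv a phi \- S.
have wL : w \in Lfun (joint PXs ks) 2%:E.
  have le12 : (1 <= 2%:E :> \bar R)%E by rewrite lee_fin ler1n.
  exact: (rpredB psiL.1 SL).
rewrite -[L2dot _ _ _ in X in (X + _)%E]/(L2dot (joint PXs ks) w w).
have {he} : (L2dot (joint PXs ks) w w < (e / (1 + oss_ratio gamma))%:E)%E := he.
move: proj; rewrite -/w -(fineK (L2dot_fin_num wL wL)) -(fineK (L2dot_fin_num VL VL)).
rewrite lee_fin lte_fin -EFinM -EFinD lte_fin ltr_pdivlMr ?ltr_pwDl// => le lt.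
by apply: le_lt_trans lt; rewrite mulrDr mulr1 lerD2l mulrC ler_wpM2r.
Qed.
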